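(* For all positive integers $n$, \[ \log_2 \log_2 c(n) \leq n^5 \quad \text{and} \quad \log_2 \log_2 \log_2 f(n) \leq n^3 . \]
   Context: A matroid is representable if it is linearly representable over some field. Let $\mathcal{M}_n$ be the set of all representable matroids on $n$ elements. For a representable matroid $M$, let $c(M)$ be the least positive characteristic of a field over which $M$ is representable, and let $f(M)$ be the order of the smallest (finite) field over which $M$ is representable; both exist for every representable matroid, by theorems of Rado. For each positive integer $n$ define $c(n) = \max\{c(M) : M \in \mathcal{M}_n\}$ and $f(n) = \max\{f(M) : M \in \mathcal{M}_n\}$ (these maxima exist and are finite, since there are finitely many isomorphism classes of $n$-element matroids). Convention: $\log_2 0 = -\infty$, so that the second inequality means $f(n) \leq 2^{2^{2^{n^3}}}$. *)

(* Defs.v *)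
From HB Require Import structures.
From mathcomp Require Import all_boot all_order all_algebra.
From mathcomp Require Import boolp reals constructive_ereal exp.

Set Implicit Arguments.
Unset Strict Implicit.
Unset Printing Implicit Defensive.

Import Order.TTheory GRing.Theory Num.Theory.
Local Open Scope ring_scope.

Section Matroid.
Variable T : finType.

Definition matroid_axiom (I : {set {set T}}) : bool :=
  [&& set0 \in I,
      [forall A : {set T}, forall B : {set T},
         (B \in I) && (A \subset B) ==> (A \in I)]
    & [forall A : {set T}, forall B : {set T},
         [&& A \in I, B \in I & (#|A| < #|B|)%N] ==>
           [exists x in B :\: A, x |: A \in I]]].

Record matroid := Matroid {
  indep : {set {set T}};
  indepP : matroid_axiom indep
}.

HB.instance Definition _ := [isSub for indep].
HB.instance Definition _ := [Finite of matroid by <:].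

End Matroid.

(* [free] is about families, so parallel elements, which may have equal
   columns, are correctly dependent. *)
Definition representable_over (F : fieldType) (n : nat) (M : matroid 'I_n) : Prop :=
  exists (m : nat) (A : 'M[F]_(m, n)),
    forall X : {set 'I_n}, (X \in indep M) = free [seq col i A | i in X].

Definition representable (n : nat) (M : matroid 'I_n) : Prop :=
  exists F : fieldType, representable_over F M.

(* The value is +oo if no natural number satisfies P, so that an upper bound on
   [least P] entails that the minimum exists. *)
Definition least (R : realType) (P : nat -> Prop) : \bar R :=
  if pselect (exists k, `[< P k >]) is left exP then (ex_minn exP)%:R%:E else +oo%E.

Definition min_char (R : realType) (n : nat) (M : matroid 'I_n) : \bar R :=
  least R (fun p => exists F : fieldType, p \in [pchar F] /\ representable_over F M).

Definition min_order (R : realType) (n : nat) (M : matroid 'I_n) : \bar R :=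
  least R (fun q => exists F : finFieldType, #|F| = q /\ representable_over F M).

(* An n-element matroid is taken on the ground set 'I_n; [matroid 'I_n] is a
   finite type, so these are maxima over finitely many matroids. *)
Definition c (R : realType) (n : nat) : \bar R :=
  \big[maxe/-oo%E]_(M : matroid 'I_n | `[< representable M >]) min_char R M.

Definition f (R : realType) (n : nat) : \bar R :=
  \big[maxe/-oo%E]_(M : matroid 'I_n | `[< representable M >]) min_order R M.

(* [lne] is the natural logarithm on \bar R, with [lne 0 = -oo] and
   [lne +oo = +oo]. *)
Definition log2 (R : realType) (x : \bar R) : \bar R := (lne x * ((ln 2)^-1)%:E)%E.

(* Main.v *)
Require Import Defs.
From HB Require Import structures.
From mathcomp Require Import all_boot all_order all_algebra all_field.
From mathcomp Require Import mpoly.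
From mathcomp Require Import boolp reals constructive_ereal exp.
From mathcomp Require Import fingroup perm zify.

(** A representation of a matroid on [n] elements is a solution of a polynomial
    system with integer coefficients, whose solutions over any field are again
    representations: bring the matrix to the identity on a basis, take its
    [r * (n - r)] other entries as unknowns, let the minors of the dependent
    sets vanish, choose for every independent set a minor that is nonzero in
    the given representation, and let one more unknown be the inverse of the
    product of the chosen minors ([matroid_system], [point_of_representation],
    [representable_of_point]).  The number [N] of unknowns, the degree [d] and
    the coefficients of this system are bounded in terms of [n].

    What makes such systems comparable between fields is an effective
    Nullstellensatz ([effective_nullstellensatz]): if [F_1, ..., F_k] of degree
    at most [d] generate the unit ideal over an infinite field, then
    [sum_j g_j F_j = 1] for some [g_j] of size at most [nss_bound N d], a number
    that depends on neither [k] nor the field.  Solvability over an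
    algebraically closed field thus becomes linear algebra: it fails exactly
    when a row vector lies in the row space of the Macaulay matrix of [F], and
    this is a question on which minors vanish, minors of order at most
    [S = nss_size N d] ([no_certificateP]).

    - Characteristic.  Over the integers these minors are at most
      [S! * H ^ S], where [H] bounds the coefficients.  A system solvable in
      characteristic zero, or in a characteristic above that bound, has
      a nonzero minor [z] of the augmented matrix at an order at which all the
      minors of the Macaulay matrix are zero; a prime divisor of [|z| + 1] does
      not divide [z], so the same pattern of minors holds in that
      characteristic ([certificate_transfer]).

    - Order.  Over an algebraically closed field of characteristic [p], the
      values allowed for one unknown are governed by the same minors, now
      polynomials of degree at most [S] in that value.  Such a value is
      therefore found in an extension of degree at most [S + 1]
      ([bounded_add_root]), and a whole solution in degree
      [tau <= (S + 1) ^ N] over the prime field ([bounded_degree_point]).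
      With the equations [x_i ^ q = x_i] added, [q = p ^ tau], the solution is
      found in the field with [q] elements ([small_finite_point]).

    The effective Nullstellensatz is proved in the ring [K[x][z]].  If the
    [F_j] generate the unit ideal, then [z] is a polynomial in the [x_i] and
    the [z F_j].  Linear combinations [Psi_0, ..., Psi_N] of these generators
    are algebraically independent with [z] integral over [K[Psi]]
    ([noether_independent]).  Counting monomials gives a nonzero relation
    [P_1(Psi, z) = 0] of bounded degree in [Psi] ([perron_relation]), and
    Gauss's lemma makes the monic minimal relation of [z] a factor of it, hence
    bounded as well ([bounded_monic_relation]).  In the monic relation of degree
    [e], the coefficient of [z ^ e] expresses [1] as a combination of the [F_j]
    ([certificate_of_monic]).

    The resulting numbers lie below the stated bounds as soon as [n >= 3]
    ([prime_bound], [order_bound]).  For [n <= 2] they are too large; there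
    the zero pattern of a normalized representation already is a representation
    over the field with two elements ([representable_binary]). *)

Set Implicit Arguments.
Unset Strict Implicit.
Unset Printing Implicit Defensive.

Import Order.TTheory GRing.Theory Num.Theory.
Local Open Scope ring_scope.

Local Notation widen i := (widen_ord (leqnSn _) i).

(** * Linear dependence and minors *)

(** The values live in a ring and only the coefficients in a field: what is
    counted are the [v i] in the span of the fewer elements [u j].  Both counting
    arguments below, for relations of bounded degree and for the number of
    independent elements, end here. *)
Lemma linear_dependence (K : fieldType) (B : comNzRingType)
    (h : {rmorphism K -> B}) (I J : finType) (v : I -> B) (u : J -> B)
    (c : I -> J -> K) :
  (#|J| < #|I|)%N -> (forall i, v i = \sum_j h (c i j) * u j) ->
  exists2 a : I -> K, exists i, a i != 0 & \sum_i h (a i) * v i = 0.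
Proof.
move=> ltJI def_v.
pose A : 'M[K]_(#|I|, #|J|) := \matrix_(i, j) c (enum_val i) (enum_val j).
have : kermx A != 0.
  rewrite -mxrank_eq0 mxrank_ker subn_eq0 -ltnNge.
  exact: leq_ltn_trans (rank_leq_col A) ltJI.
case/rowV0Pn=> w /sub_kermxP wA0 w_neq0.
exists (fun i => w 0 (enum_rank i)).
  have /rV0Pn[i wi] := w_neq0.
  by exists (enum_val i); rewrite enum_valK.
under eq_bigr do rewrite def_v mulr_sumr.
rewrite exchange_big big1 //= => j _.
under eq_bigr do rewrite mulrA -rmorphM.
rewrite -mulr_suml -rmorph_sum.
have -> : \sum_i w 0 (enum_rank i) * c i j = (w *m A) 0 (enum_rank j).
  rewrite mxE (reindex (@enum_rank I)) /=; last first.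
    by exists enum_val => i _; rewrite ?enum_valK ?enum_rankK.
  by apply: eq_bigr => i _; rewrite mxE !enum_rankK.
by rewrite wA0 mxE rmorph0 mul0r.
Qed.

Lemma row_free_rowsub (F : fieldType) m n t (A : 'M[F]_(m, n))
    (h : 'I_t -> 'I_m) :
  injective h -> row_free A -> row_free (rowsub h A).
Proof.
move=> inj_h /row_freeP[B AB1]; apply/row_freeP.
exists (B *m (rowsub h 1%:M)^T).
rewrite mulmxA mul_rowsub_mx AB1; apply/matrixP=> i j.
rewrite mxE (bigD1 (h i)) //= !mxE eqxx mul1r big1 ?addr0 => [|k nik].
  by rewrite (inj_eq inj_h) eq_sym.
by rewrite !mxE eq_sym (negPf nik) mul0r.
Qed.

(** Minors commute with ring morphisms and ranks do not; this is what allows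
    ranks to be compared between fields. *)
Lemma rank_minorP (F : fieldType) m n (A : 'M[F]_(m, n)) t :
  reflect (exists f : 'I_t -> 'I_m, exists g : 'I_t -> 'I_n,
             \det (mxsub f g A) != 0) (t <= \rank A)%N.
Proof.
apply: (iffP idP) => [le_t | [f [g]]]; last first.
  rewrite -unitfE -[_ \is a _]/(_ \in unitmx) -row_free_unit => /eqP rkt.
  have defB : mxsub f g A = rowsub f 1%:M *m A *m colsub g 1%:M.
    by rewrite mul_rowsub_mx mul1mx mulmx_colsub mulmx1 -mxsub_comp.
  rewrite -[X in (X <= _)%N]rkt defB.
  exact: leq_trans (mxrankM_maxl _ _) (mxrankM_maxr _ _).
pose f := maxrankfun A \o widen_ord le_t.
have frA : row_free (rowsub f A).
  rewrite rowsub_comp; apply: row_free_rowsub (maxrowsub_free A).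
  by move=> i j /(congr1 val) /= /val_inj.
have fullA : row_full (rowsub f A)^T by rewrite /row_full mxrank_tr.
exists f, (fullrankfun fullA).
have := fullrowsub_unit fullA; rewrite -unitmx_tr unitmxE unitfE.
by congr (\det _ != 0); apply/matrixP=> i j; rewrite !mxE.
Qed.

(** * Gauss's lemma over completely integrally closed domains *)

(** Division by [Q] writes every power of [C] over [S] through the powers below
    the degree of [Q], so that one denominator serves for all. *)
Lemma bounded_matrix_powers (S K : comNzRingType) (iota : {rmorphism S -> K}) e
    (C : 'M[K]_e.+1) (C0 : 'M[S]_e.+1) (b : S) (Q : {poly S}) :
  Q \is monic -> horner_mx C (map_poly iota Q) = 0 ->
  map_mx iota C0 = iota b *: C ->
  forall j, exists Cj : 'M[S]_e.+1,
    map_mx iota Cj = iota (b ^+ (size Q).-1) *: C ^+ j.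
Proof.
move=> monQ QC0 defC0 j; set D := (size Q).-1.
have small i : (i <= D)%N -> exists Ci : 'M[S]_e.+1,
    map_mx iota Ci = iota (b ^+ D) *: C ^+ i.
  move=> le_iD; exists (b ^+ (D - i) *: C0 ^+ i).
  rewrite map_mxZ (rmorphXn (map_mx iota)) /= defC0 exprZn scalerA -rmorphXn -rmorphM.
  by rewrite -exprD subnK.
pose r := Pdiv.Ring.rmodp 'X^j Q.
have size_r : (size r <= D)%N.
  rewrite -ltnS prednK ?Pdiv.Ring.ltn_rmodpN0 ?monic_neq0 //.
  by rewrite size_poly_gt0 monic_neq0.
have -> : C ^+ j = \sum_(i < size r) iota r`_i *: C ^+ i.
  transitivity (horner_mx C (map_poly iota 'X^j)).
    by rewrite map_polyXn rmorphXn /= horner_mx_X.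
  rewrite (Pdiv.RingMonic.rdivp_eq monQ 'X^j) rmorphD rmorphM /= rmorphD rmorphM /=.
  rewrite QC0 mulr0 add0r -/r -[r in LHS]coefK poly_def !rmorph_sum.
  apply: eq_bigr => i _ /=; rewrite map_polyZ horner_mxZ map_polyXn rmorphXn /=.
  by rewrite horner_mx_X.
suff [Cs defCs] : {Cs : 'I_(size r) -> 'M[S]_e.+1 &
    forall i, map_mx iota (Cs i) = iota (b ^+ D) *: C ^+ i}.
  exists (\sum_(i < size r) r`_i *: Cs i); rewrite raddf_sum scaler_sumr /=.
  apply: eq_bigr => i _.
  by rewrite map_mxZ defCs !scalerA mulrC.
apply: (choice (P := fun i Ci => map_mx iota Ci = _)) => i.
by apply: small; apply: leq_trans size_r; apply: ltnW.
Qed.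

(** The hypothesis says that the powers of the fraction [a / b] have the common
    denominator [c]; over a non-Noetherian ring this is weaker than integrality
    of [a / b]. *)
Definition completely_integrally_closed (S : idomainType) :=
  forall a b c : S, c != 0 -> b != 0 ->
  (forall k, exists q, c * a ^+ k = q * b ^+ k) -> exists q, a = q * b.

(** The leading coefficients of the powers of [P] are powers of that of [P], so
    the definition applies to them; subtracting the leading term keeps the
    hypothesis, by the binomial formula. *)
Lemma power_coefs_cic (S : idomainType) (P : {poly S}) (b c : S) :
  completely_integrally_closed S -> c != 0 -> b != 0 ->
  (forall k, exists q, c *: P ^+ k = b ^+ k *: q) -> exists q, P = b *: q.
Proof.
move=> cicS; have [m] := ubnP (size P); elim: m P => // m IHm P ltPm c0 b0 cP.
have [->|P0] := eqVneq P 0; first by exists 0; rewrite scaler0.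
have [l defl] : exists q, lead_coef P = q * b.
  apply: (cicS _ _ c) => // k; have [q /(congr1 lead_coef)] := cP k.
  rewrite -!mul_polyC !lead_coefM !lead_coefC lead_coef_exp => ->.
  by exists (lead_coef q); rewrite mulrC.
pose L := l *: 'X^((size P).-1); pose P' := P - b *: L.
have ltP' : (size P' < size P)%N.
  have [->|P'0] := eqVneq P' 0; first by rewrite size_poly0 size_poly_gt0.
  have leP' : (size P' <= size P)%N.
    rewrite (leq_trans (size_polyD _ _)) // geq_max leqnn size_polyN /L scalerA.
    rewrite (leq_trans (size_scale_leq _ _)) // size_polyXn prednK //.
    by rewrite size_poly_gt0.
  rewrite ltn_neqAle leP' andbT; apply: contraNneq P'0 => eqs.
  rewrite -lead_coef_eq0 lead_coefE eqs coefB -lead_coefE defl.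
  by rewrite /L !coefZ coefXn eqxx mulr1 mulrC subrr.
have [||||q defq] := IHm P' => //.
- exact: leq_trans ltP' _.
- move=> k.
  have [qs defqs] : {qs : nat -> {poly S} & forall k, c *: P ^+ k = b ^+ k *: qs k}.
    exact: (choice (P := fun k q => _ = b ^+ k *: q)).
  exists (\sum_(i < k.+1) (qs (k - i)%N * (- L) ^+ i) *+ 'C(k, i)).
  rewrite /P' exprDn !scaler_sumr; apply: eq_bigr => i _.
  rewrite -!scalerMnr -scalerN exprZn; congr (_ *+ _).
  rewrite scalerAl defqs -scalerAr -scalerAl scalerA -exprD subnKC //.
  by rewrite -ltnS.
by exists (q + L); rewrite scalerDr -defq /P' subrK.
Qed.

(** Gauss's lemma in the form needed for minimal polynomials: a factor, up to
    denominators, of a monic [Q] is a constant times a monic polynomial.  Over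
    the fraction field write [P = b mu] with [mu] monic, the characteristic
    polynomial of its companion matrix [C].  As [mu] divides [Q], [Q(C) = 0],
    the powers of [C] have a common denominator, hence so do the powers of
    [mu = det (X - C)].  Complete integral closure thus replaces unique
    factorization in the usual proof. *)
Lemma monic_factor_cic (S : idomainType) (P H Q : {poly S}) (beta : S) :
  completely_integrally_closed S -> P != 0 -> Q \is monic -> beta != 0 ->
  beta *: Q = H * P -> exists q, P = lead_coef P *: q.
Proof.
move=> cicS P0 monQ beta0 defHP; set b := lead_coef P.
have b0 : b != 0 by rewrite lead_coef_eq0.
pose K := {fraction S}; pose iota : {rmorphism S -> K} := @tofrac S.
have iota_inj : injective iota by move=> x y /eqP; rewrite tofrac_eq => /eqP.
have ib0 : iota b != 0 by rewrite tofrac_eq0.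
pose mu : {poly K} := (iota b)^-1 *: map_poly iota P.
have defP : map_poly iota P = iota b *: mu by rewrite scalerA divff // scale1r.
have mon_mu : mu \is monic.
  rewrite monicE lead_coefZ lead_coef_map_inj // -/b ?rmorph0 //.
  by rewrite mulVf.
have sz_mu : size mu = size P.
  by rewrite size_scale ?invr_eq0 // size_map_inj_poly ?rmorph0.
have [sP|] := leqP (size P) 1.
  exists 1; rewrite [LHS]size1_polyC // alg_polyC /b lead_coefE.
  by rewrite (size1_polyC sP) size_polyC; case: (P`_0 != 0); rewrite coefC.
move=> sP.
have [e [C [C0 [defC0 charC]]]] : exists e, exists C : 'M[K]_e.+1,
    exists C0 : 'M[S]_e.+1, map_mx iota C0 = iota b *: C /\ char_poly C = mu.
  pose C0 : 'M[S]_((size mu).-1) := \matrix_(i, j)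
    if i == (size mu).-2 :> nat then - P`_j else b * (i.+1 == j :> nat)%:R.
  have defC0 : map_mx iota C0 = iota b *: companionmx mu.
    apply/matrixP=> i j; rewrite !mxE; case: ifP => _.
      by rewrite rmorphN mulrN -coefZ -defP coef_map.
    by rewrite rmorphM rmorph_nat.
  have := companionmxK mon_mu; move: (companionmx mu) C0 defC0.
  rewrite sz_mu; case: (size P) sP => [|[|e]] // _ C C0 defC0 charC.
  by exists e, C, C0.
have QC0 : horner_mx C (map_poly iota Q) = 0.
  have : horner_mx C (map_poly iota (beta *: Q)) = 0.
    by rewrite defHP rmorphM /= defP rmorphM /= horner_mxZ -charC
       Cayley_Hamilton scaler0 mulr0.
  rewrite map_polyZ horner_mxZ => /eqP; rewrite scaler_eq0 tofrac_eq0.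
  by rewrite (negPf beta0) => /eqP.
have bnd := bounded_matrix_powers monQ QC0 defC0.
set c := b ^+ (size Q).-1 in bnd.
have [Cs defCs] := @choice _ _ (fun j Cj => map_mx iota Cj = iota c *: C ^+ j) bnd.
apply: (@power_coefs_cic _ _ _ (c ^+ e.+1)) => // [|k].
  by rewrite !expf_neq0.
(* The binomial expansion of [c (X - C) ^ k], which has coefficients in [S]. *)
pose M : 'M[{poly S}]_e.+1 := \sum_(i < k.+1)
  ('X ^+ (k - i) *: map_mx polyC ((- 1) ^+ i *: Cs i)) *+ 'C(k, i).
have defM : map_mx (map_poly iota) M = (iota c)%:P *: char_poly_mx C ^+ k.
  rewrite /char_poly_mx GRing.exprDn_comm; last exact/esym/scalar_mxC.
  rewrite raddf_sum scaler_sumr /=; apply: eq_bigr => i _.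
  rewrite raddfMn /= -!scalerMnr; congr (_ *+ _).
  rewrite map_mxZ /= rmorphXn /= map_polyX -map_mx_comp.
  rewrite -scalemx1 exprZn expr1n -scalerAl mul1r scalerA mulrC -scalerA.
  congr (_ *: _); rewrite -rmorphN -rmorphXn /= -[- C]scaleN1r exprZn.
  rewrite -map_mxZ scalerA mulrC -scalerA -defCs.
  apply/matrixP => r s; rewrite !mxE /= map_polyC.
  by congr (_%:P); rewrite -[LHS]/(iota _) rmorphM rmorphXn rmorphN rmorph1.
have det_exp (A : 'M[{poly K}]_e.+1) : \det (A ^+ k) = \det A ^+ k.
  by elim: (k) => [|j IHj]; rewrite ?expr0 ?det1 // !exprS det_mulmx IHj.
exists (\det M); apply: (@map_inj_poly _ _ iota); rewrite ?rmorph0 //.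
rewrite !map_polyZ (rmorphXn (map_poly iota)) /= defP exprZn -det_map_mx defM detZ det_exp.
rewrite -/(char_poly C) charC -mul_polyC !rmorphXn /= -!mul_polyC !rmorphXn /=.
by rewrite mulrCA.
Qed.

(** * Polynomials in several variables *)

(** If [b ^ k] divides [c * a ^ k] for all [k], comparing leading exponents for
    large [k] shows that the leading monomial of [b] divides that of [a]; the
    division step [a - t * b] has the same property, and the leading monomial
    decreases. *)
Lemma mpoly_completely_integrally_closed n (K : fieldType) :
  completely_integrally_closed {mpoly K[n]}.
Proof.
move=> a b c c0 b0; elim/mleadrect: a => a IHa divab.
have [->|a0] := eqVneq a 0; first by exists 0; rewrite mul0r.
have le_ba : (mlead b <= mlead a)%MM.
  apply/mnm_lepP => i; rewrite leqNgt; apply/negP => lt_ab.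
  (* With this exponent the excess of [b] over [a] at [i] outweighs [mlead c i]. *)
  have [q defq] := divab (mlead c i).+1.
  have q0 : q != 0.
    by apply: contraNneq (mulf_neq0 c0 (expf_neq0 (mlead c i).+1 a0));
       rewrite defq => ->; rewrite mul0r.
  have /(congr1 (fun m : 'X_{1..n} => m i)) := congr1 (@mlead _ _) defq.
  rewrite !mleadM ?expf_neq0 // !mleadX // !mnmDE !mulmnE => eq_i.
  have : (mlead a i * (mlead c i).+1 + (mlead c i).+1
          <= mlead b i * (mlead c i).+1)%N by rewrite -mulSnr leq_mul2r lt_ab.
  rewrite leqNgt => /negP; apply.
  rewrite (leq_trans _ (_ : mlead c i + mlead a i * (mlead c i).+1 < _)%N) //.
    by rewrite ltnS eq_i leq_addl.
  by rewrite addnC ltn_add2l.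
pose t := (a@_(mlead a) / b@_(mlead b)) *: 'X_[mlead a - mlead b].
have lcb0 : b@_(mlead b) != 0 by rewrite mleadc_eq0.
have lca0 : a@_(mlead a) != 0 by rewrite mleadc_eq0.
have lt0 : a@_(mlead a) / b@_(mlead b) != 0 by rewrite mulf_neq0 ?invr_eq0.
have t0 : t != 0 by rewrite -msize_poly_eq0 msizeZ // msizeX.
have mlt : mlead (t * b) = mlead a.
  by rewrite mleadM // mleadZ // mleadXm submK.
pose a' := a - t * b.
have [a'0|a'0] := eqVneq a' 0; first by exists t; apply/eqP; rewrite -subr_eq0 -/a' a'0.
have [|k|q defq] := IHa a'.
- have le_a' : (mlead a' <= mlead a)%O.
    by rewrite (le_trans (mleadB_le _ _)) // mlt joinxx.
  rewrite lt_neqAle le_a' andbT; apply: contraNneq a'0 => eq_l.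
  rewrite -mleadc_eq0 eq_l mcoeffB -{2}mlt mleadM // mleadcM.
  by rewrite /t mleadZ // mcoeffZ mleadXm mcoeffX eqxx mulr1 divfK ?subrr.
- have [qs defqs] : {qs : nat -> {mpoly K[n]} &
      forall k, c * a ^+ k = qs k * b ^+ k}.
    exact: (choice (P := fun k q => _ = q * b ^+ k)).
  exists (\sum_(i < k.+1) (qs (k - i)%N * (- t) ^+ i) *+ 'C(k, i)).
  rewrite /a' exprDn mulr_sumr mulr_suml; apply: eq_bigr => i _.
  rewrite mulrnAr mulrnAl; congr (_ *+ _).
  rewrite -mulNr exprMn !mulrA defqs -!mulrA; congr (_ * _).
  by rewrite mulrCA -exprD subnK // -ltnS.
by exists (q + t); rewrite mulrDl -defq /a' subrK.
Qed.

Lemma ord_widen_ind n (P : 'I_n.+1 -> Prop) :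
  P ord_max -> (forall i : 'I_n, P (widen i)) -> forall i, P i.
Proof.
move=> Pmax Pw i; case: (unliftP ord_max i) => [j|] -> //.
by have -> : lift ord_max j = widen j by apply: val_inj; rewrite /= /bump leqNgt ltn_ord.
Qed.

Lemma coef_muni n (R : nzRingType) (p : {mpoly R[n.+1]}) j m :
  (muni p)`_j@_m = p@_(mnmwiden m + U_(ord_max) *+ j).
Proof.
rewrite muniE coef_sum raddf_sum /= [in RHS](mpolyE p) raddf_sum /=.
apply: eq_bigr => k _; rewrite coefZ coefXn mulr_natr mcoeffMn !mcoeffZ !mcoeffX.
rewrite -[LHS]mulr_natr -mulrA -natrM mulnb.
congr (_ * _%:R); congr nat_of_bool; apply/andP/eqP => [[/eqP <- /eqP ->]|->].
  apply/mnmP; apply: ord_widen_ind => [|i]; rewrite mnmDE mulmnE mnm1E.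
    by rewrite mnmwiden_ordmax eqxx mul1n.
  by rewrite mnmwiden_widen mnmE -val_eqE /= gtn_eqF ?addn0.
split; last by rewrite mnmDE mulmnE mnm1E mnmwiden_ordmax eqxx mul1n.
apply/eqP/mnmP => i; rewrite mnmE mnmDE mulmnE mnm1E mnmwiden_widen.
by rewrite -val_eqE /= gtn_eqF ?addn0.
Qed.

Lemma muni_inj n (R : nzRingType) : injective (@muni n R).
Proof.
move=> p q eq_pq; apply/mpolyP => m.
have defm : m = (mnmwiden [multinom m (widen i) | i < n]
                 + U_(ord_max) *+ m ord_max)%MM.
  apply/mnmP; apply: ord_widen_ind => [|i]; rewrite mnmDE mulmnE mnm1E.
    by rewrite mnmwiden_ordmax eqxx mul1n.
  by rewrite mnmwiden_widen mnmE -val_eqE /= gtn_eqF ?addn0.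
by rewrite defm -!coef_muni eq_pq.
Qed.

Lemma mmap_muni n (R S : comNzRingType) (h : {rmorphism R -> S})
    (y : 'I_n.+1 -> S) (p : {mpoly R[n.+1]}) :
  mmap h y p
    = (map_poly (mmap h (fun i : 'I_n => y (widen i))) (muni p)).[y ord_max].
Proof.
rewrite muniE rmorph_sum horner_sum /=; apply: eq_bigr => m _.
rewrite map_polyZ map_polyXn hornerZ hornerXn /= mmapZ mmapX -mulrA.
congr (_ * _); rewrite /mmap1 big_ord_recr /=; congr (_ * _).
by apply: eq_bigr => i _; rewrite mnmE.
Qed.

Lemma map_mpoly_inj n (R S : nzRingType) (h : {rmorphism R -> S}) :
  injective h -> injective (map_mpoly h : {mpoly R[n]} -> {mpoly S[n]}).
Proof.
move=> inj_h p q eq_pq; apply/mpolyP => m; apply: inj_h.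
by rewrite -!mcoeff_map_mpoly eq_pq.
Qed.

Lemma msize_map_mpoly n (R S : nzRingType) (h : {rmorphism R -> S}) (p : {mpoly R[n]}) :
  (msize (map_mpoly h p) <= msize p)%N.
Proof.
rewrite leqNgt; apply/negP => lt_p.
have nz : map_mpoly h p != 0 by rewrite -msize_poly_eq0 -lt0n (leq_trans _ lt_p).
have := mleadc_eq0 (map_mpoly h p); rewrite (negPf nz) mcoeff_map_mpoly.
rewrite memN_msupp_eq0; first by rewrite raddf0 eqxx.
by apply: msize_mdeg_ge; rewrite -ltnS mlead_deg.
Qed.

Definition infinite_type (T : eqType) := forall s : seq T, exists x, x \notin s.

Lemma poly_nonroot (K : fieldType) (p : {poly K}) :
  infinite_type K -> p != 0 -> exists x, p.[x] != 0.
Proof.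
move=> infK p0; apply/not_existsP => allroot.
have roots k : exists2 s : seq K, uniq s & size s = k.
  elim: k => [|k [s us <-]]; first by exists [::].
  by have [x xs] := infK s; exists (x :: s); rewrite //= xs.
have [s us sz] := roots (size p).
suff : (size s < size p)%N by rewrite sz ltnn.
apply: max_poly_roots p0 _ us; apply/allP => x _.
by apply/negPn/negP; apply: allroot.
Qed.

(** A nonzero specialization of the leading coefficient in the last variable
    leaves a nonzero polynomial in that variable alone. *)
Lemma mpoly_nonroot n (K : fieldType) (p : {mpoly K[n]}) :
  infinite_type K -> p != 0 -> exists v, p.@[v] != 0.
Proof.
move=> infK; elim: n p => [|n IHn] p p0.
  exists (fun=> 0); have := nvar0_mpolyC p.
  by move: p0 => /[swap] ->; rewrite mpolyC_eq0 mevalC.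
have up0 : muni p != 0 by rewrite -(raddf0 (@muni n K)) (inj_eq (@muni_inj _ _)).
have [|v] := IHn (lead_coef (muni p)); first by rewrite lead_coef_eq0.
set q := map_poly (meval v) (muni p) => lc0.
have [x qx] : exists x, q.[x] != 0.
  apply: poly_nonroot => //; apply: contraNneq lc0 => q0.
  by rewrite lead_coefE -coef_map -/q q0 coef0.
pose w i := if @unlift n.+1 ord_max i is Some j then v j else x.
exists w; rewrite /meval mmap_muni.
have -> : w ord_max = x by rewrite /w unlift_none.
suff -> : map_poly (mmap idfun (fun i => w (widen i))) (muni p) = q by [].
apply: eq_map_poly => r; apply: meval_eq => i; rewrite /w.
have -> : widen i = lift ord_max i by apply: val_inj; rewrite /= /bump leqNgt ltn_ord.
by rewrite liftK.
Qed.

(** * Integral dependence after a linear change of variables *)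

Section Integrality.
Variables (K : fieldType) (B : idomainType) (h : {rmorphism K -> B}).

Lemma integral_mmap (R : comNzRingType) (f : {rmorphism R -> B}) M
    (y : 'I_M -> B) (p : {mpoly K[M]}) :
  (forall c, integralOver f (h c)) -> (forall i, integralOver f (y i)) ->
  integralOver f (mmap h y p).
Proof.
move=> int_h int_y; rewrite /mmap; elim/big_rec: _ => [|m x _ IHx].
  exact: integral0.
apply: integral_add IHx; apply: integral_mul => //.
rewrite /mmap1; elim/big_rec: _ => [|i z _ IHz]; first exact: integral1.
apply: integral_mul IHz; elim: (m i) => [|k IHk]; first exact: integral1.
by rewrite exprS; apply: integral_mul.
Qed.

Lemma integral_const M (y : 'I_M -> B) c : integralOver (mmap h y) (h c).
Proof. by have := integral_id (mmap h y) c%:MP; rewrite /= mmapC. Qed.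

Lemma integral_var M (y : 'I_M -> B) i : integralOver (mmap h y) (y i).
Proof.
have := integral_id (mmap h y) 'X_i; rewrite /= mmapX mmap1U.
exact.
Qed.

Lemma integral_trans M M' (y : 'I_M -> B) (y' : 'I_M' -> B) b :
  (forall i, integralOver (mmap h y') (y i)) ->
  integralOver (mmap h y) b -> integralOver (mmap h y') b.
Proof.
move=> int_y [p mon_p root_p].
apply: (integral_root_monic (p := map_poly (mmap h y) p)) => //.
  exact: monic_map.
apply/integral_poly => i; rewrite coef_map.
by apply: integral_mmap => // c; apply: integral_const.
Qed.

Definition homog_part M k (r : {mpoly K[M]}) : {mpoly K[M]} :=
  \sum_(m <- msupp r | mdeg m == k) r@_m *: 'X_[m].

Lemma coef_homog_part M k (r : {mpoly K[M]}) m :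
  (homog_part k r)@_m = if mdeg m == k then r@_m else 0.
Proof.
transitivity (if mdeg m == k then
    (\sum_(m' <- msupp r) r@_m' *: 'X_[m'])@_m else 0); last by rewrite -mpolyE.
rewrite /homog_part !raddf_sum big_mkcond /=.
transitivity (\sum_(m' <- msupp r) if mdeg m == k then
    (r@_m' *: 'X_[m'])@_m else 0); last by case: ifP => // _; rewrite big1.
apply: eq_bigr => m' _; rewrite mcoeffZ mcoeffX.
by case: (m' =P m) => [-> //|_]; rewrite mulr0 !if_same.
Qed.

Section Shift.
Variables (M : nat) (c : 'I_M -> K).

Definition shift_var (i : 'I_M) : {poly {mpoly K[M]}} :=
  ('X_i)%:P + (c i)%:MP *: 'X.

Definition shift : {mpoly K[M]} -> {poly {mpoly K[M]}} :=
  mmap (polyC \o @mpolyC M K) shift_var.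

Lemma shift_top_monomial (m : 'X_{1..M}) :
  (size (mmap1 shift_var m) <= (mdeg m).+1)%N /\
  (mmap1 shift_var m)`_(mdeg m) = (\prod_i c i ^+ m i)%:MP.
Proof.
pose W k (r : {poly {mpoly K[M]}}) g := (size r <= k.+1)%N /\ r`_k = g%:MP.
have W1 : W 0%N 1 1 by rewrite /W size_poly1 coef1.
have WM k r g k' r' g' : W k r g -> W k' r' g' -> W (k + k')%N (r * r') (g * g').
  move=> [sr cr] [sr' cr']; split.
    rewrite (leq_trans (size_polyMleq _ _)) // -subn1 leq_subLR.
    by rewrite (leq_trans (leq_add sr sr')) // addSn addnS add1n.
  rewrite coefM (bigD1 (inord k)) //= inordK ?ltnS ?leq_addr // addKn cr cr'.
  rewrite mpolyCM big1 ?addr0 // => j; rewrite -val_eqE /= inordK ?ltnS ?leq_addr //.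
  rewrite neq_ltn => /orP[ltjk|ltkj].
    rewrite [r'`__]nth_default ?mulr0 // (leq_trans sr') // ltn_subRL.
    by rewrite ltn_add2r.
  by rewrite nth_default ?mul0r // (leq_trans sr).
suff : W (\sum_i m i)%N (mmap1 shift_var m) (\prod_i c i ^+ m i).
  by rewrite /W -mdegE.
rewrite /mmap1; elim/big_rec3: _ => // i g r k _ Wr; apply: (WM _ _ _ _ _ _ _ Wr).
elim: (m i) => [|e IHe]; first by rewrite !expr0.
rewrite !exprS -[e.+1]add1n; apply: (WM _ _ _ _ _ _ _ IHe); split.
  rewrite (leq_trans (size_polyD _ _)) // geq_max.
  rewrite (leq_trans (size_polyC_leq1 _)) // (leq_trans (size_scale_leq _ _)) //.
  by rewrite size_polyX.
by rewrite coefD coefC coefZ coefX mulr1 add0r.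
Qed.

(** The top coefficient in ['X] after the substitution is the value at [c] of the
    top homogeneous part: a generic choice of [c] makes it a nonzero constant. *)
Lemma shift_top k (r : {mpoly K[M]}) : (msize r <= k.+1)%N ->
  (size (shift r) <= k.+1)%N /\ (shift r)`_k = ((homog_part k r).@[c])%:MP.
Proof.
move=> sz_r.
have size_le m : m \in msupp r -> (mdeg m <= k)%N.
  by move/msize_mdeg_lt => lt_m; rewrite -ltnS (leq_trans lt_m).
split.
  rewrite /shift /mmap big_seq (leq_trans (size_sum _ _ _)) //.
  apply/bigmax_leqP_seq => m m_r _; rewrite mul_polyC.
  rewrite (leq_trans (size_scale_leq _ _)) //.
  by have [/leq_trans-> //] := shift_top_monomial m; rewrite ltnS size_le.
rewrite /homog_part (raddf_sum (meval c)) (raddf_sum (@mpolyC M K)) big_mkcond /=.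
rewrite /shift /mmap coef_sum.
rewrite [LHS]big_seq [RHS]big_seq; apply: eq_bigr => m m_r.
rewrite mul_polyC coefZ; have [sz_m top_m] := shift_top_monomial m.
case: ifPn => [/eqP <-|neq_k].
  by rewrite top_m mevalZ mevalX mpolyCM.
rewrite [_`_k]nth_default ?mulr0 // (leq_trans sz_m) // ltn_neqAle neq_k.
exact: size_le.
Qed.

Lemma shift_eval (y : 'I_M -> B) (w : B) (r : {mpoly K[M]}) :
  (map_poly (mmap h (fun i => y i - h (c i) * w)) (shift r)).[w] = mmap h y r.
Proof.
rewrite /shift [X in map_poly _ X]/mmap [RHS]/mmap rmorph_sum horner_sum; apply: eq_bigr => m _ /=.
rewrite rmorphM hornerM /= map_polyC hornerC /= [mmap _ _ _]mmapC.
congr (_ * _); rewrite /mmap1 rmorph_prod horner_prod; apply: eq_bigr => i _.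
rewrite rmorphXn horner_exp /=; congr (_ ^+ _).
rewrite rmorphD /= map_polyC map_polyZ map_polyX /= hornerD hornerC hornerZ hornerX.
by rewrite [mmap _ _ 'X_i]mmapX mmap1U [mmap _ _ _]mmapC subrK.
Qed.
End Shift.

(** The classical linear change of variables over an infinite field: a relation
    [q(y, w) = 0] becomes monic in [w], up to a nonzero constant, in terms of
    [y_i - c_i w], as soon as the top homogeneous part [G] of [q], with the last
    variable set to [1], does not vanish at [c]. *)
Lemma noether_step M (y : 'I_M -> B) (w : B) (q : {poly {mpoly K[M]}}) :
    infinite_type K -> q != 0 -> (map_poly (mmap h y) q).[w] = 0 ->
  exists c : 'I_M -> K, let y' i := y i - h (c i) * w in
    integralOver (mmap h y') w /\ forall i, integralOver (mmap h y') (y i).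
Proof.
move=> infK q0 qyw.
pose deg j := (j + (msize q`_j).-1)%N.
pose A := [pred j : 'I_(size q) | q`_j != 0].
pose d := \max_(j in A) deg j.
have le_d j : q`_j != 0 -> (deg j <= d)%N.
  move=> qj; have lt_j : (j < size q)%N.
    by rewrite ltnNge; apply: contra qj => /leq_sizeP->.
  exact: (leq_bigmax_cond (Ordinal lt_j)).
(* The total degree [d] of [q] is attained by some coefficient, so [G] is nonzero. *)
have [j0 qj0 def_d] : exists2 j0, q`_j0 != 0 & d = deg j0.
  have [|j qj def_d] := @eq_bigmax_cond _ A deg.
    have lt_q : ((size q).-1 < size q)%N by rewrite prednK ?size_poly_gt0.
    apply/card_gt0P; exists (Ordinal lt_q).
    by rewrite inE -lead_coefE lead_coef_eq0.
  by exists j; [exact: qj|exact: def_d].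
pose G := \sum_(j < size q) homog_part (d - j)%N q`_j.
have G0 : G != 0.
  pose m0 := mlead q`_j0.
  have deg_m0 : (j0 + mdeg m0 = d)%N.
    by rewrite def_d /deg -mlead_deg.
  have lt_j0 : (j0 < size q)%N.
    by rewrite ltnNge; apply: contra qj0 => /leq_sizeP->.
  have : G@_m0 != 0.
    rewrite raddf_sum (bigD1 (Ordinal lt_j0)) //= coef_homog_part.
    rewrite -deg_m0 addKn eqxx big1 ?addr0 ?mleadc_eq0 //= => j nj0.
    rewrite coef_homog_part; case: eqP => // eq_m0.
    have [-> | qj] := eqVneq q`_j 0; first by rewrite mcoeff0.
    have := leq_trans (leq_addr _ _) (le_d _ qj); rewrite -deg_m0 => le_jd.
    case/eqP: nj0; apply: val_inj => /=; apply/eqP.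
    by rewrite -(eqn_add2r (mdeg m0)) {1}eq_m0 subnKC.
  by apply: contraNneq => ->; rewrite mcoeff0.
have [c Gc] := mpoly_nonroot infK G0.
exists c => y'.
pose Q := \sum_(j < size q) shift c q`_j * 'X^j.
have szQ_j (j : 'I_(size q)) : (size (shift c q`_j * 'X^j)%R <= d.+1)%N /\
    (shift c q`_j * 'X^j)`_d = ((homog_part (d - j)%N q`_j).@[c])%:MP.
  have [-> | qj] := eqVneq q`_j 0.
    rewrite /shift /homog_part /mmap msupp0 !big_nil mul0r size_poly0 coef0.
    by rewrite meval0.
  have le_jd : (j <= d)%N := leq_trans (leq_addr _ _) (le_d _ qj).
  have [|sz_s top_s] := @shift_top _ c (d - j)%N q`_j.
    by rewrite -[msize _]prednK ?lt0n ?msize_poly_eq0 // ltnS leq_subRL // le_d.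
  split; last by rewrite coefMXn ltnNge le_jd.
  rewrite (leq_trans (size_polyMleq _ _)) // size_polyXn addnS /=.
  by rewrite (leq_trans (leq_add sz_s (leqnn j))) // addSn subnK.
have szQ : (size Q <= d.+1)%N.
  by rewrite (leq_trans (size_sum _ _ _)) //; apply/bigmax_leqP => j _;
     have [] := szQ_j j.
have topQ : Q`_d = (G.@[c])%:MP.
  rewrite coef_sum (raddf_sum (meval c)) (raddf_sum (@mpolyC M K)); apply: eq_bigr => j _.
  by have [] := szQ_j j.
have Qw : (map_poly (mmap h y') Q).[w] = 0.
  rewrite -qyw -[q in RHS]coefK poly_def !rmorph_sum !horner_sum /=.
  apply: eq_bigr => j _; rewrite rmorphM /= map_polyXn hornerM hornerXn.
  by rewrite shift_eval map_polyZ map_polyXn hornerZ hornerXn.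
have int_w : integralOver (mmap h y') w.
  exists ((G.@[c]^-1)%:MP *: Q).
    have Gc_inv : (G.@[c]^-1)%:MP * (G.@[c])%:MP = 1 :> {mpoly K[M]}.
      by rewrite -mpolyCM mulVf // mpolyC1.
    have szQE : size Q = d.+1.
      apply/eqP; rewrite eqn_leq szQ ltnNge; apply: contra Gc => /leq_sizeP/(_ d).
      by rewrite topQ leqnn => /(_ isT) /eqP; rewrite mpolyC_eq0.
    have Gc0 : (G.@[c]^-1)%:MP != 0 :> {mpoly K[M]}.
      by rewrite mpolyC_eq0 invr_eq0.
    by rewrite monicE lead_coefZ lead_coefE szQE topQ Gc_inv.
  by rewrite /root map_polyZ hornerZ Qw mulr0.
split=> // i; rewrite -[y i](subrK (h (c i) * w)); apply: integral_add.
  exact: integral_var.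
by apply: integral_mul => //; apply: integral_const.
Qed.
End Integrality.

(** * Algebraic relations of bounded degree *)

(** The monomials with all exponents below [k]: unlike those of bounded total
    degree, they are counted by a power. *)
Definition box_monomial n k (g : {ffun 'I_n -> 'I_k}) : 'X_{1..n} :=
  [multinom (g i : nat) | i < n].

Lemma box_monomial_inj n k : injective (@box_monomial n k).
Proof.
move=> g g' eq_g; apply/ffunP => i; apply: val_inj.
by have /(congr1 (fun m : 'X_{1..n} => m i)) := eq_g; rewrite !mnmE.
Qed.

Lemma mdeg_box_monomial n k (g : {ffun 'I_n -> 'I_k}) :
  (mdeg (box_monomial g) <= n * k.-1)%N.
Proof.
rewrite mdegE -[X in (_ <= X * _)%N]card_ord -sum_nat_const.
by apply: leq_sum => i _; rewrite mnmE; case: (g i); case: k {g} => [|k] [].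
Qed.

Lemma mcoeff_sum_box n k (R : nzRingType) (a : {ffun 'I_n -> 'I_k} -> R) g :
  (\sum_g a g *: 'X_[box_monomial g])@_(box_monomial g) = a g.
Proof.
rewrite raddf_sum (bigD1 g) //= mcoeffZ mcoeffX eqxx mulr1 big1 ?addr0 // => g' ng.
by rewrite mcoeffZ mcoeffX (inj_eq (@box_monomial_inj _ _)) (negPf ng) mulr0.
Qed.

Lemma mpoly_box n k (R : nzRingType) (r : {mpoly R[n]}) : (msize r <= k)%N ->
  r = \sum_(g : {ffun 'I_n -> 'I_k}) r@_(box_monomial g) *: 'X_[box_monomial g].
Proof.
move=> sz_r; apply/mpolyP => m.
have [/forallP lt_m|/forallPn[i]] := boolP [forall i, m i < k]%N.
  pose g := [ffun i => Ordinal (lt_m i)].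
  have -> : m = box_monomial g by apply/mnmP => i; rewrite mnmE ffunE.
  by rewrite mcoeff_sum_box.
rewrite -leqNgt => le_km; rewrite memN_msupp_eq0; last first.
  apply/msize_mdeg_ge/(leq_trans sz_r)/(leq_trans le_km).
  by rewrite mdegE (bigD1 i) //= leq_addr.
rewrite raddf_sum big1 //= => g _; rewrite mcoeffZ mcoeffX.
case: eqP => [def_m|_]; rewrite ?mulr0 //.
by move: le_km; rewrite -def_m mnmE leqNgt ltn_ord.
Qed.

Lemma msizeM_leq n (R : idomainType) (p q : {mpoly R[n]}) :
  (msize (p * q) <= (msize p + msize q).-1)%N.
Proof.
have [->|p0] := eqVneq p 0; first by rewrite mul0r msize0.
have [->|q0] := eqVneq q 0; first by rewrite mulr0 msize0.
by rewrite msizeM.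
Qed.

Section Degrees.
Variables (K : fieldType) (N : nat).
Local Notation B := {poly {mpoly K[N]}}.

Definition polyCC : K -> B := polyC \o @mpolyC N K.
HB.instance Definition _ := GRing.RMorphism.on polyCC.

Definition degree_box a d (x : B) :=
  (size x <= a.+1)%N /\ forall j, (msize x`_j <= d.+1)%N.

Lemma degree_boxM a d a' d' x x' :
  degree_box a d x -> degree_box a' d' x' ->
  degree_box (a + a') (d + d') (x * x').
Proof.
move=> [sx dx] [sx' dx']; split.
  rewrite (leq_trans (size_polyMleq _ _)) // -subn1 leq_subLR add1n.
  by rewrite (leq_trans (leq_add sx sx')) // addSn addnS.
move=> j; rewrite coefM (leq_trans (msize_sum _ _ _)) //.
apply/bigmax_leqP => i _; rewrite (leq_trans (msizeM_leq _ _)) //.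
rewrite -subn1 leq_subLR add1n (leq_trans (leq_add (dx i) (dx' _))) //.
by rewrite addSn addnS.
Qed.

Lemma degree_boxX a d x k : degree_box a d x -> degree_box (a * k) (d * k) (x ^+ k).
Proof.
move=> dx; elim: k => [|k IHk].
  rewrite !muln0 expr0; split; first by rewrite size_poly1.
  by move=> j; rewrite coef1; case: eqP => _; rewrite ?msize1 ?msize0.
by rewrite exprS !mulnS; apply: degree_boxM.
Qed.

Lemma degree_boxW a d a' d' x : (a <= a')%N -> (d <= d')%N ->
  degree_box a d x -> degree_box a' d' x.
Proof.
move=> le_a le_d [sx dx]; split; first exact: leq_trans sx _.
by move=> j; apply: leq_trans (dx j) _.
Qed.

Lemma degree_box_ex x : exists a d, degree_box a d x.
Proof.
exists (size x), (\max_(j < size x) msize x`_j); split=> // j.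
have [lt_j|le_j] := ltnP j (size x).
  by rewrite leqW // (leq_bigmax (Ordinal lt_j)).
by rewrite nth_default // msize0.
Qed.

Lemma degree_box_mmap1 M (y : 'I_M -> B) a d m :
  (forall i, degree_box a d (y i)) ->
  degree_box (a * mdeg m) (d * mdeg m) (mmap1 y m).
Proof.
move=> dy; rewrite mdegE /mmap1 !big_distrr /=.
elim/big_rec3: _ => [|i x e e' _ IH].
  split; first by rewrite size_poly1.
  by move=> j; rewrite coef1; case: eqP => _; rewrite ?msize1 ?msize0.
by apply: degree_boxM => //; apply: degree_boxX.
Qed.

Lemma degree_box_expand a d x : degree_box a d x ->
  x = \sum_(gb : {ffun 'I_N -> 'I_d.+1} * 'I_a.+1)
        polyCC (x`_(gb.2)@_(box_monomial gb.1))
        * (('X_[box_monomial gb.1])%:P * 'X^(gb.2)).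
Proof.
move=> [sx dx].
rewrite -(pair_bigA _ (fun (g : {ffun 'I_N -> 'I_d.+1}) (b : 'I_a.+1) =>
        polyCC (x`_b@_(box_monomial g))
        * (('X_[box_monomial g])%:P * 'X^b))) exchange_big /=.
have defx : x = \sum_(b < a.+1) (x`_b)%:P * 'X^b.
  rewrite -[x in LHS]coefK (poly_def) (big_ord_widen _ (fun i => x`_i *: 'X^i) sx).
  rewrite big_mkcond; apply: eq_bigr => i _; rewrite mul_polyC.
  by case: ltnP => // le_i; rewrite nth_default // scale0r.
rewrite [LHS]defx; apply: eq_bigr => b _; rewrite {1}(mpoly_box (dx b)) rmorph_sum mulr_suml /=.
apply: eq_bigr => g _; rewrite mulrA /polyCC /=; congr (_ * _).
by rewrite -polyCM mul_mpolyC.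
Qed.

(** A relation of bounded degree between [M + 1] polynomials, found by counting:
    there are [m ^ (M + 1)] monomials in [y] and [w] with exponents below [m],
    and they lie in a space whose dimension is the left side of the inequality.
    The bound on the coefficients of [q] is a total degree in the [M] first
    elements. *)
Lemma perron_relation M (y : 'I_M -> B) (w : B) a d m :
    (forall i, degree_box a d (y i)) -> degree_box a d w ->
    ((d * (M.+1 * m.-1)).+1 ^ N * (a * (M.+1 * m.-1)).+1 < m ^ M.+1)%N ->
  exists q : {poly {mpoly K[M]}},
    [/\ q != 0, (map_poly (mmap polyCC y) q).[w] = 0 &
        forall j, (msize q`_j <= (M * m.-1).+1)%N].
Proof.
move=> dy dw lt_card; set e := (M.+1 * m.-1)%N in lt_card.
pose I : finType := ({ffun 'I_M -> 'I_m} * 'I_m)%type.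
pose v (i : I) := mmap1 y (box_monomial i.1) * w ^+ i.2.
have dv i : degree_box (a * e) (d * e) (v i).
  have le_e : (mdeg (box_monomial i.1) + i.2 <= e)%N.
    rewrite /e mulSn addnC leq_add ?mdeg_box_monomial //.
    by case: i.2; case: (m) => [|m'] [].
  apply: (@degree_boxW (a * mdeg (box_monomial i.1) + a * i.2)
                      (d * mdeg (box_monomial i.1) + d * i.2)).
  - by rewrite -mulnDr leq_mul2l le_e orbT.
  - by rewrite -mulnDr leq_mul2l le_e orbT.
  by apply: degree_boxM; [apply: degree_box_mmap1|apply: degree_boxX].
have [|r [[g0 b0] r0] rel] :=
    linear_dependence _ (fun i => degree_box_expand (dv i)).
  by rewrite !card_prod !card_ffun !card_ord -expnSr.
pose q := \sum_(b < m) (\sum_g r (g, b) *: 'X_[box_monomial g]) *: 'X^b.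
have coefq j : q`_j =
    if insub j is Some b then \sum_g r (g, b) *: 'X_[box_monomial g] else 0.
  rewrite coef_sum; case: insubP => [b _ <-|le_mj].
    rewrite (bigD1 b) //= coefZ coefXn eqxx mulr1 [X in _ + X]big1 ?addr0 // => b' nb.
    by rewrite coefZ coefXn eq_sym (inj_eq val_inj) (negPf nb) mulr0.
  rewrite big1 // => b _; rewrite coefZ coefXn; case: eqP => [eq_jb|_].
    by rewrite eq_jb ltn_ord in le_mj.
  by rewrite mulr0.
exists q; split.
- apply: contraNneq r0 => q0; have := mcoeff_sum_box (fun g => r (g, b0)) g0.
  by have := coefq b0; rewrite valK => <-; rewrite q0 coef0 mcoeff0 => <-.
- transitivity (\sum_g \sum_b polyCC (r (g, b)) * v (g, b)); last first.
    by rewrite pair_bigA -[RHS]rel; apply: eq_bigr => -[].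
  rewrite exchange_big rmorph_sum horner_sum /=; apply: eq_bigr => b _.
  rewrite map_polyZ map_polyXn hornerZ hornerXn rmorph_sum mulr_suml /=.
  by apply: eq_bigr => g _; rewrite mmapZ mmapX mulrA.
move=> j; rewrite coefq; case: insub => [b|]; last by rewrite msize0.
rewrite (leq_trans (msize_sum _ _ _)) //; apply/bigmax_leqP => g _.
by rewrite (leq_trans (msizeZ_le _ _)) // msizeX ltnS mdeg_box_monomial.
Qed.
End Degrees.

(** * Integral extensions and algebraic independence *)

Lemma mmap1D n (B : comNzRingType) (x : 'I_n -> B) m1 m2 :
  mmap1 x (m1 + m2) = mmap1 x m1 * mmap1 x m2.
Proof.
rewrite /mmap1 -big_split; apply: eq_bigr => i _ /=.
by rewrite mnmDE exprD.
Qed.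

Lemma mmap1MU n (B : comNzRingType) (x : 'I_n -> B) i j :
  mmap1 x (U_(i) *+ j)%MM = x i ^+ j.
Proof.
rewrite /mmap1 (bigD1 i) //= mulmnE mnm1E eqxx mul1n big1 ?mulr1 // => k nk.
by rewrite mulmnE mnm1E eq_sym (negPf nk) mul0n expr0.
Qed.

Section IntegralRank.
Variables (K : fieldType) (B : idomainType) (h : {rmorphism K -> B}).
Variables (M L : nat) (y : 'I_M -> B) (x : 'I_L -> B).
Variables (p : 'I_L -> {poly {mpoly K[M]}}).
Hypotheses (mon_p : forall i, p i \is monic).
Hypothesis root_p : forall i, (map_poly (mmap h y) (p i)).[x i] = 0.

Let e := (\max_i size (p i)).+1.
Let H := \max_i \max_(j < size (p i)) msize (p i)`_j.

(** Elements that are combinations of monomials in [x] of small exponents with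
    coefficients in [K[y]] of degree at most [H * T]. *)
Let reduced T (b : B) := exists q : {ffun 'I_L -> 'I_e} -> {mpoly K[M]},
  (forall g, (msize (q g) <= (H * T).+1)%N) /\
  b = \sum_g mmap h y (q g) * mmap1 x (box_monomial g).

Let reduced0 T : reduced T 0.
Proof.
exists (fun=> 0); split=> [g|]; first by rewrite msize0.
by rewrite big1 // => g _; rewrite rmorph0 mul0r.
Qed.

Let reducedD T b b' : reduced T b -> reduced T b' -> reduced T (b + b').
Proof.
move=> [q [sq ->]] [q' [sq' ->]]; exists (fun g => q g + q' g); split=> [g|].
  by rewrite (leq_trans (msizeD_le _ _)) // geq_max sq sq'.
by rewrite -big_split; apply: eq_bigr => g _ /=; rewrite rmorphD mulrDl.
Qed.

Let reducedM T r b : (msize r <= H.+1)%N -> reduced T b ->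
  reduced T.+1 (mmap h y r * b).
Proof.
move=> sr [q [sq ->]]; exists (fun g => r * q g); split=> [g|].
  rewrite (leq_trans (msizeM_leq _ _)) // -subn1 leq_subLR add1n.
  by rewrite (leq_trans (leq_add sr (sq g))) // addSn addnS mulnS.
by rewrite mulr_sumr; apply: eq_bigr => g _; rewrite rmorphM mulrA.
Qed.

Let reducedW T T' b : (T <= T')%N -> reduced T b -> reduced T' b.
Proof.
move=> le_T [q [sq ->]]; exists q; split=> // g.
by rewrite (leq_trans (sq g)) // ltnS leq_mul2l le_T orbT.
Qed.

(** Each use of a monic relation lowers the degree in [x] by at least one and
    raises the degree of the coefficients in [y] by at most [H]: a monomial of
    degree [T] in [x] has coefficients of degree at most [H * T]. *)
Let reduced_monomial m : reduced (mdeg m) (mmap1 x m).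
Proof.
have [k] := ubnP (mdeg m); elim: k m => // k IHk m lt_mk.
have [/forallP lt_m|/forallPn[i]] := boolP [forall i, m i < e]%N.
  pose g0 : {ffun 'I_L -> 'I_e} := [ffun i => Ordinal (lt_m i)].
  have defm : m = box_monomial g0 by apply/mnmP => i; rewrite mnmE ffunE.
  rewrite [X in mmap1 x X]defm.
  exists (fun g => if g == g0 then 1 else 0); split=> [g|].
    by case: ifP => _; rewrite ?msize1 ?msize0.
  rewrite (bigD1 g0) //= eqxx rmorph1 mul1r big1 ?addr0 // => g /negPf->.
  by rewrite rmorph0 mul0r.
rewrite -leqNgt => le_em; pose s := (size (p i)).-1.
have sz_p : size (p i) = s.+1.
  by rewrite prednK // size_poly_gt0 monic_neq0.
have le_sm : (s <= m i)%N.
  rewrite ltnW // (leq_trans _ le_em) // -sz_p ltnW // ltnS.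
  exact: leq_bigmax.
pose m' := (m - U_(i) *+ s)%MM.
have def_m : m = (m' + U_(i) *+ s)%MM.
  rewrite submK //; apply/mnm_lepP => j; rewrite mulmnE mnm1E.
  by case: eqP => [<-|_]; rewrite ?mul1n // mul0n.
have s_gt0 : (0 < s)%N.
  rewrite lt0n; apply: contraTneq (oner_neq0 B) => s0.
  have := root_p i; have -> : p i = 1.
    have /monicP := mon_p i; rewrite lead_coefE sz_p s0 /= => lc1.
    by rewrite [LHS]size1_polyC ?sz_p ?s0 // lc1.
  by rewrite rmorph1 hornerC => ->; rewrite eqxx.
have rootE : x i ^+ s = - \sum_(j < s) mmap h y (p i)`_j * x i ^+ j.
  have := root_p i; rewrite -[p i in LHS]coefK poly_def sz_p big_ord_recr /=.
  have /monicP := mon_p i; rewrite lead_coefE sz_p /= => ->.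
  rewrite scale1r rmorphD hornerD /= map_polyXn hornerXn rmorph_sum horner_sum.
  move/(canRL (addKr _)); rewrite addr0 => ->; congr (- _).
  by apply: eq_bigr => j _ /=; rewrite map_polyZ map_polyXn hornerZ hornerXn.
have -> : mmap1 x m =
    \sum_(j < s) mmap h y (- (p i)`_j) * mmap1 x (m' + U_(i) *+ j)%MM.
  have -> : mmap1 x m = mmap1 x m' * x i ^+ s by rewrite {1}def_m mmap1D mmap1MU.
  rewrite rootE -sumrN mulr_sumr; apply: eq_bigr => j _.
  by rewrite mmap1D mmap1MU rmorphN mulrN mulNr mulrCA.
have deg_m : mdeg m = (mdeg m' + s)%N.
  by rewrite {1}def_m mdegD mdegMn mdeg1 mul1n.
elim/big_rec: _ => [|j b _ red_b]; first exact: reduced0.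
apply: reducedD red_b.
have := IHk (m' + U_(i) *+ j)%MM; rewrite mdegD mdegMn mdeg1 mul1n => red_j.
have lt_j : (mdeg m' + j < mdeg m)%N by rewrite deg_m ltn_add2l.
apply: (reducedW lt_j); apply: reducedM.
  rewrite msizeN ltnW // ltnS (leq_trans _ (leq_bigmax i)) //.
  by rewrite (leq_trans _ (leq_bigmax (@Ordinal (size (p i)) j _))) //;
     rewrite sz_p ltnW // ltnS.
by apply: red_j; exact: leq_trans lt_j _.
Qed.

(** If [M < L], the [T ^ L] monomials in [x] with exponents below [T] lie in
    a space of dimension [O(T ^ M)], so they are dependent for large [T]. *)
Lemma integral_rank_aux : (forall r, r != 0 -> mmap h x r != 0) -> (L <= M)%N.
Proof.
move=> indep_x; rewrite leqNgt; apply/negP => lt_ML.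
(* The constant in front of [T ^ M], plus one. *)
pose T := (e ^ L * (H * L).+1 ^ M).+1.
pose W := (H * (L * T)).+1.
pose v (g : {ffun 'I_L -> 'I_T}) := mmap1 x (box_monomial g).
have red_v g : reduced (L * T) (v g).
  apply: reducedW (reduced_monomial _).
  by rewrite (leq_trans (mdeg_box_monomial _)) // leq_mul2l leq_pred orbT.
have [q sq] := choice red_v.
pose u (gd : {ffun 'I_L -> 'I_e} * {ffun 'I_M -> 'I_W}) :=
  mmap1 y (box_monomial gd.2) * mmap1 x (box_monomial gd.1).
have def_v g : v g = \sum_gd h ((q g gd.1)@_(box_monomial gd.2)) * u gd.
  have [szq ->] := sq g; rewrite -(pair_bigA _ (fun (a : {ffun 'I_L -> 'I_e})
    (b : {ffun 'I_M -> 'I_W}) => h ((q g a)@_(box_monomial b)) * u (a, b))) /=.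
  apply: eq_bigr => a _; rewrite {1}(mpoly_box (szq a)) rmorph_sum mulr_suml.
  by apply: eq_bigr => b _ /=; rewrite mmapZ mmapX mulrA.
have [|a [g0 a0] rel] := linear_dependence _ def_v.
  rewrite card_prod !card_ffun !card_ord.
  have leW : (W <= (H * L).+1 * T)%N by rewrite /W mulSn -mulnA -add1n leq_add2r.
  apply: (@leq_ltn_trans (e ^ L * ((H * L).+1 * T) ^ M)).
    rewrite leq_mul2l; case: (M) => [|M']; rewrite ?leqnn ?orbT //.
    by rewrite leq_exp2r // leW orbT.
  apply: (@leq_trans (T ^ M.+1)); last by rewrite leq_pexp2l.
  by rewrite expnMn mulnA expnS ltn_mul2r expn_gt0 /= ltnSn.
have : \sum_g a g *: 'X_[box_monomial g] != 0 :> {mpoly K[L]}.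
  apply/negP => /eqP s0; case/negP: a0.
  by rewrite -[a g0]mcoeff_sum_box s0 mcoeff0.
move/indep_x; rewrite rmorph_sum /= -[X in _ != X]rel.
by under eq_bigr do rewrite mmapZ mmapX; rewrite eqxx.
Qed.
End IntegralRank.

(** This takes the place of the invariance of the transcendence degree; a
    degree count replaces transcendence bases. *)
Lemma integral_rank (K : fieldType) (B : idomainType) (h : {rmorphism K -> B})
    M L (y : 'I_M -> B) (x : 'I_L -> B) :
  (forall r, r != 0 -> mmap h x r != 0) ->
  (forall i, integralOver (mmap h y) (x i)) -> (L <= M)%N.
Proof.
move=> indep int_x.
have [i|p pP] := choice (P := fun i p => p \is monic /\
    (map_poly (mmap h y) p).[x i] = 0).
  by have [p mon_p /rootP] := int_x i; exists p.
by apply: (@integral_rank_aux _ _ h M L y x p) => // i; have [] := pP i.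
Qed.

(** * Noether normalization and bounded monic relations *)

(** The degree in the coefficient variables alone is additive on products: the
    last coefficients of largest degree of the two factors multiply to a term
    that nothing cancels.  A factor thus has no larger degree than the product. *)
Lemma mpoly_factor_degree n (R : idomainType) (p q : {poly {mpoly R[n]}}) E :
  p != 0 -> (forall j, msize (p * q)`_j <= E)%N -> forall j, (msize q`_j <= E)%N.
Proof.
move=> p0 szpq.
(* A coefficient of largest degree, the last one if there are several. *)
have last_max (r : {poly {mpoly R[n]}}) : r != 0 -> exists j,
    [/\ r`_j != 0, forall i, (msize r`_i <= msize r`_j)%N &
        forall i, (j < i)%N -> (msize r`_i < msize r`_j)%N].
  move=> r0; pose mx := \max_(i < size r) msize r`_i.
  have le_mx i : (msize r`_i <= mx)%N.
    have [lt_i|le_i] := ltnP i (size r); first exact: (leq_bigmax (Ordinal lt_i)).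
    by rewrite nth_default // msize0.
  have mx_gt0 : (0 < mx)%N.
    rewrite (leq_trans _ (le_mx (size r).-1)) // lt0n msize_poly_eq0.
    by rewrite -lead_coefE lead_coef_eq0.
  have bnd i : msize r`_i == mx -> (i <= size r)%N.
    move=> /eqP def_mx; apply: contraTT mx_gt0; rewrite -ltnNge => lt_i.
    by rewrite -def_mx nth_default ?msize0 // ltnW.
  have ex : exists i, msize r`_i == mx.
    have szr : (0 < #|'I_(size r)|)%N by rewrite card_ord size_poly_gt0.
    by have [i def_mx] := @bigop.eq_bigmax _ (fun i : 'I_(size r) => msize r`_i) szr;
       exists i; rewrite -def_mx.
  case: (ex_maxnP ex bnd) => j /eqP def_j max_j; exists j; split.
  - by rewrite -msize_poly_eq0 def_j -lt0n.
  - by move=> i; rewrite def_j.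
  move=> i lt_ji; rewrite def_j ltn_neqAle le_mx andbT.
  by apply: contraL lt_ji => /max_j; rewrite -leqNgt.
have [-> j|q0] := eqVneq q 0; first by rewrite coef0 msize0.
have [j [pj le_pj lt_pj]] := last_max p p0.
have [k [qk le_qk lt_qk]] := last_max q q0.
suff le_kE : (msize q`_k <= E)%N by move=> i; apply: leq_trans (le_qk i) _.
rewrite leqNgt; apply/negP => lt_Ek.
have pj_gt0 : (0 < msize p`_j)%N by rewrite lt0n msize_poly_eq0.
have szjk : msize (p`_j * q`_k) = (msize p`_j + msize q`_k).-1 by rewrite msizeM.
have lt_E : (E < (msize p`_j + msize q`_k).-1)%N.
  by rewrite (leq_trans lt_Ek) // -subn1 leq_subRL ?leq_add2r ?addn_gt0 ?pj_gt0.
suff : (msize (p`_j * q`_k) < (msize p`_j + msize q`_k).-1)%N.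
  by rewrite szjk ltnn.
have := szpq (j + k)%N; rewrite coefM.
rewrite (bigD1 (inord j)) //= inordK ?ltnS ?leq_addr // addKn.
set S := \sum_(i < _ | _) _ => szS.
have -> : p`_j * q`_k = (p`_j * q`_k + S) - S by rewrite addrK.
apply: leq_ltn_trans (msizeD_le _ _) _; rewrite gtn_max msizeN.
rewrite (leq_ltn_trans szS lt_E) /= -[X in (_ < X)%N]prednK; last first.
  by rewrite (leq_ltn_trans _ lt_E).
rewrite ltnS (leq_trans (msize_sum _ _ _)) //; apply/bigmax_leqP => i.
rewrite -val_eqE /= inordK ?ltnS ?leq_addr // neq_ltn => ne_ij.
rewrite (leq_trans (msizeM_leq _ _)) // -!subn1 leq_sub2r //.
rewrite -ltnS subn1 prednK ?addn_gt0 ?pj_gt0 //.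
case/orP: ne_ij => [lt_ij|lt_ji].
  by rewrite -addnS leq_add // lt_qk // ltn_subRL ltn_add2r.
by rewrite -addSn leq_add // lt_pj.
Qed.

Section Noether.
Variables (K : fieldType) (B : idomainType) (h : {rmorphism K -> B}).
Hypothesis infK : infinite_type K.

(** The hypothesis that every [M + 1 > L] elements are dependent allows
    [noether_step] to eliminate generators until [L] are left; the coefficients
    [A] stay in [K] because each step is a linear change. *)
Lemma noether_normalization L s (y : 'I_(s + L) -> B) :
    (forall M (y : 'I_M -> B) w, (L <= M)%N ->
       exists2 q : {poly {mpoly K[M]}}, q != 0 & (map_poly (mmap h y) q).[w] = 0) ->
  exists A : 'I_L -> 'I_(s + L) -> K,
    forall j, integralOver (mmap h (fun i => \sum_j h (A i j) * y j)) (y j).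
Proof.
move=> dep; elim: s y => [|s IHs] y.
  exists (fun i j => (i == j)%:R) => j.
  have -> : y j = (fun i => \sum_j h ((i == j)%:R) * y j) j.
    rewrite (bigD1 j) //= eqxx rmorph1 mul1r big1 ?addr0 // => i ni.
    by rewrite eq_sym (negPf ni) rmorph0 mul0r.
  exact: integral_var.
pose w := y ord_max; pose y0 (i : 'I_(s + L)) := y (widen i).
have [q q0 qyw] := dep _ y0 w (leq_addl s L).
have [c [int_w int_y0]] := noether_step infK q0 qyw.
pose y' (i : 'I_(s + L)) := y0 i - h (c i) * w.
have [A int_y'] := IHs y'.
pose A' i (j : 'I_(s + L).+1) : K :=
  if @unlift (s + L).+1 ord_max j is Some k then A i k
  else - \sum_k A i k * c k.
exists A'.
have Psi_eq i : \sum_j h (A' i j) * y j = \sum_j h (A i j) * y' j.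
  rewrite [LHS]big_ord_recr /= {2}/A' unlift_none rmorphN mulNr rmorph_sum mulr_suml.
  rewrite -sumrB; apply: eq_bigr => k _; rewrite /A'.
  have {1}-> : widen k = lift ord_max k.
    by apply: val_inj; rewrite /= /bump leqNgt ltn_ord.
  by rewrite liftK /y' mulrBr rmorphM mulrA.
have -> : mmap h (fun i => \sum_j h (A' i j) * y j)
        = mmap h (fun i => \sum_j h (A i j) * y' j).
  by congr mmap; apply: funext => i; apply: Psi_eq.
have int_all (b : B) : integralOver (mmap h y') b ->
    integralOver (mmap h (fun i => \sum_j h (A i j) * y' j)) b.
  by apply: integral_trans.
apply: (@ord_widen_ind (s + L) (fun j => integralOver _ (y j))) => [|i].
  exact: int_all.
exact: int_all (int_y0 i).
Qed.

(** A relation between the [N + 1] normalized elements would, by one more step,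
    make [N + 1] independent elements [x] integral over [N] elements,
    against [integral_rank].  The third hypothesis says that the [x_i] belong
    to the algebra generated by the [y_j]. *)
Lemma noether_independent N s (y : 'I_(s + N.+1) -> B) (x : 'I_N.+1 -> B) :
    (forall M (y : 'I_M -> B) w, (N.+1 <= M)%N ->
       exists2 q : {poly {mpoly K[M]}}, q != 0 & (map_poly (mmap h y) q).[w] = 0) ->
    (forall r, r != 0 -> mmap h x r != 0) ->
    (forall (R : comNzRingType) (f : {rmorphism R -> B}),
       (forall c, integralOver f (h c)) -> (forall j, integralOver f (y j)) ->
       forall i, integralOver f (x i)) ->
  exists2 A : 'I_N.+1 -> 'I_(s + N.+1) -> K,
    forall b, b != 0 -> mmap h (fun i => \sum_j h (A i j) * y j) b != 0 &
    forall i, integralOver (mmap h (fun i => \sum_j h (A i j) * y j)) (x i).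
Proof.
move=> dep indep_x gen_x.
have [A int_y] := noether_normalization y dep.
exists A; last by apply: gen_x int_y; apply: integral_const.
set Psi := fun i => _ in int_y *.
move=> b b0; apply/negP => /eqP bPsi.
have ub0 : muni b != 0 by rewrite -(raddf0 (@muni N K)) (inj_eq (@muni_inj _ _)).
rewrite mmap_muni in bPsi.
have [c [int_w int_y0]] := noether_step infK ub0 bPsi.
suff : (N.+1 <= N)%N by rewrite ltnn.
apply: (integral_rank indep_x) => i.
apply: (integral_trans (y := Psi)); last by apply: gen_x int_y i; apply: integral_const.
by apply: ord_widen_ind => [|k]; [apply: int_w|apply: int_y0].
Qed.

(** A relation [P] of least degree divides, up to constants, the monic relation
    that expresses integrality.  By Gauss's lemma its primitive part [mu] is
    monic, and it divides [P1], which bounds its coefficients. *)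
Lemma bounded_monic_relation L (Psi : 'I_L -> B) (z : B)
    (P1 : {poly {mpoly K[L]}}) E :
    (forall b, b != 0 -> mmap h Psi b != 0) -> integralOver (mmap h Psi) z ->
    P1 != 0 -> (map_poly (mmap h Psi) P1).[z] = 0 ->
    (forall j, msize P1`_j <= E)%N ->
  exists mu : {poly {mpoly K[L]}}, [/\ mu \is monic,
    (map_poly (mmap h Psi) mu).[z] = 0 & forall j, (msize mu`_j <= E)%N].
Proof.
move=> indep [Q monQ /rootP Qz] P10 P1z szP1.
pose rel (P : {poly {mpoly K[L]}}) := (map_poly (mmap h Psi) P).[z] = 0.
have ex : exists k, `[< exists P, [/\ P != 0, rel P & size P = k] >].
  by exists (size P1); apply/asboolP; exists P1.
case: (ex_minnP ex) => k /asboolP[P [P0 Pz szP]] min_k.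
have rel0 R : rel R -> (size R < k)%N -> R = 0.
  move=> Rz ltR; apply: contraTeq ltR => R0; rewrite -leqNgt; apply: min_k.
  by apply/asboolP; exists R.
have [mu defP] : exists q, P = lead_coef P *: q.
  apply: (@monic_factor_cic _ _ (Q %/ P) Q (lead_coef P ^+ scalp Q P)) => //.
  - exact: mpoly_completely_integrally_closed.
  - by rewrite expf_neq0 // lead_coef_eq0.
  suff rem0 : Q %% P = 0 by rewrite Pdiv.Idomain.divp_eq rem0 addr0.
  apply: rel0; last by rewrite -szP Pdiv.Idomain.ltn_modpN0.
  have -> : Q %% P = lead_coef P ^+ scalp Q P *: Q - Q %/ P * P.
    by rewrite Pdiv.Idomain.divp_eq addrC addKr.
  rewrite /rel rmorphB rmorphM /= map_polyZ hornerD hornerN hornerM hornerZ.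
  by rewrite Qz [(map_poly _ P).[z]]Pz !mulr0 subrr.
have lcP0 : lead_coef P != 0 by rewrite lead_coef_eq0.
have monmu : mu \is monic.
  rewrite monicE; have := congr1 lead_coef defP.
  by rewrite lead_coefZ -[LHS]mulr1 => /(mulfI lcP0) <-.
have muz : rel mu.
  have := Pz; rewrite defP /rel map_polyZ hornerZ => /eqP.
  by rewrite mulf_eq0 (negPf (indep _ lcP0)) => /eqP.
have szmu : size mu = k by rewrite -szP defP size_scale.
exists mu; split=> //.
have defP1 : P1 = Pdiv.Ring.rdivp P1 mu * mu.
  suff rem0 : Pdiv.Ring.rmodp P1 mu = 0.
    by rewrite {1}(Pdiv.RingMonic.rdivp_eq monmu P1) rem0 addr0.
  apply: rel0; last by rewrite -szmu Pdiv.Ring.ltn_rmodpN0 // monic_neq0.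
  have -> : Pdiv.Ring.rmodp P1 mu = P1 - Pdiv.Ring.rdivp P1 mu * mu.
    by rewrite {2}(Pdiv.RingMonic.rdivp_eq monmu P1) addrC addKr.
  rewrite /rel rmorphB rmorphM /= hornerD hornerN hornerM.
  by rewrite P1z [(map_poly _ mu).[z]]muz mulr0 subrr.
apply: (@mpoly_factor_degree _ _ (Pdiv.Ring.rdivp P1 mu)).
  by apply: contraNneq P10 => eq0; rewrite defP1 eq0 mul0r.
by move=> j; rewrite -defP1.
Qed.
End Noether.

(** * The effective Nullstellensatz *)

Definition certificate (R : comNzRingType) N (J : finType) (D : nat)
    (F : J -> {mpoly R[N]}) :=
  exists2 g : J -> {mpoly R[N]}, forall j, (msize (g j) <= D)%N &
    \sum_j g j * F j = 1.

(** With [m = (d (N + 2)) ^ N (N + 2) + 1], [perron_relation] gives a relation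
    of degree at most [(N + 1) * m.-1]; substituting elements of degree [d]
    multiplies this by [d]. *)
Definition nss_bound N d := (d * (N.+1 * ((d * N.+2) ^ N * N.+2))).+1.

Section EffectiveNullstellensatz.
Variables (K : fieldType) (N : nat) (J : finType) (F : J -> {mpoly K[N]}) (d : nat).
Hypotheses (infK : infinite_type K) (d_gt0 : (0 < d)%N).
Hypothesis szF : forall j, (msize (F j) <= d.+1)%N.
Local Notation B := {poly {mpoly K[N]}}.
Local Notation h := (@polyCC K N).

(** A space that contains the generators [x_i] and [F_j * z], hence also what
    Noether normalization makes of them, and in which the degrees are bounded. *)
Definition cone_element (x : B) := exists l : {mpoly K[N]}, exists2 c : J -> K,
  (msize l <= d.+1)%N & x = l%:P + (\sum_j c j *: F j)%:P * 'X.

Definition bounded_ideal D (p : {mpoly K[N]}) :=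
  exists2 g : J -> {mpoly K[N]}, forall j, (msize (g j) <= D)%N &
    p = \sum_j g j * F j.

(** A property of the products of [T] cone elements: every positive power of
    [z] comes with a coefficient in the ideal, with cofactors of bounded
    degree. *)
Definition graded_bound T (v : B) := forall t,
  (msize v`_t <= (d * T).+1)%N /\ ((0 < t)%N -> bounded_ideal (d * T).+1 v`_t).

Lemma bounded_ideal0 D : bounded_ideal D 0.
Proof.
exists (fun=> 0) => [j|]; first by rewrite msize0.
by rewrite big1 // => j _; rewrite mul0r.
Qed.

Lemma bounded_idealD D p q :
  bounded_ideal D p -> bounded_ideal D q -> bounded_ideal D (p + q).
Proof.
move=> [g sg ->] [g' sg' ->]; exists (fun j => g j + g' j) => [j|].
  by rewrite (leq_trans (msizeD_le _ _)) // geq_max sg sg'.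
by rewrite -big_split; apply: eq_bigr => j _; rewrite mulrDl.
Qed.

Lemma bounded_ideal_sum D (I : finType) (P : pred I) (p : I -> {mpoly K[N]}) :
  (forall i, P i -> bounded_ideal D (p i)) -> bounded_ideal D (\sum_(i | P i) p i).
Proof.
move=> ip; elim/big_rec: _ => [|i q Pi]; first exact: bounded_ideal0.
by apply: bounded_idealD; apply: ip.
Qed.

Lemma bounded_idealM D E p r : (msize r <= E.+1)%N ->
  bounded_ideal D.+1 p -> bounded_ideal (D + E).+1 (p * r).
Proof.
move=> sr [g sg ->]; exists (fun j => r * g j) => [j|].
  rewrite (leq_trans (msizeM_leq _ _)) // -subn1 leq_subLR add1n.
  by rewrite (leq_trans (leq_add sr (sg j))) // addSn addnS addnC.
by rewrite mulr_suml; apply: eq_bigr => j _; rewrite mulrC mulrA.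
Qed.

Lemma bounded_idealZ D c p : bounded_ideal D p -> bounded_ideal D (c *: p).
Proof.
move=> [g sg ->]; exists (fun j => c *: g j) => [j|].
  by rewrite (leq_trans (msizeZ_le _ _)).
by rewrite scaler_sumr; apply: eq_bigr => j _; rewrite scalerAl.
Qed.

Lemma bounded_idealW D D' p : (D <= D')%N -> bounded_ideal D p -> bounded_ideal D' p.
Proof.
by move=> le_D [g sg ->]; exists g => // j; apply: leq_trans (sg j) _.
Qed.

Lemma graded_bound1 : graded_bound 0 1.
Proof.
move=> t; rewrite muln0 coef1; split; first by case: eqP => _; rewrite ?msize1 ?msize0.
by case: t => // t _; apply: bounded_ideal0.
Qed.

Lemma graded_boundM T v x :
  graded_bound T v -> cone_element x -> graded_bound T.+1 (v * x).
Proof.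
move=> gv [l [c sl ->]] t; rewrite mulrDr coefD coefMC mulrA coefMX coefMC.
rewrite mulnS addnC.
set u := \sum_j _; have su : (msize u <= d.+1)%N.
  rewrite (leq_trans (msize_sum _ _ _)) //; apply/bigmax_leqP => j _.
  by rewrite (leq_trans (msizeZ_le _ _)).
have szM (r s : {mpoly K[N]}) : (msize r <= (d * T).+1)%N -> (msize s <= d.+1)%N ->
    (msize (r * s) <= (d * T + d).+1)%N.
  move=> sr ss; rewrite (leq_trans (msizeM_leq _ _)) // -subn1 leq_subLR add1n.
  by rewrite (leq_trans (leq_add sr ss)) // addSn addnS.
split.
  rewrite (leq_trans (msizeD_le _ _)) // geq_max szM //=; last by have [] := gv t.
  by case: eqP => _; rewrite ?msize0 // szM //; have [] := gv t.-1.
move=> t_gt0; rewrite -[t == 0%N]negbK -lt0n t_gt0 /=; apply: bounded_idealD.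
  by apply: bounded_idealM => //; have [_] := gv t; apply.
exists (fun j => c j *: v`_t.-1) => [j|].
  rewrite (leq_trans (msizeZ_le _ _)) // (leq_trans (proj1 (gv t.-1))) //.
  by rewrite ltnS leq_addr.
rewrite mulr_sumr; apply: eq_bigr => j _.
by rewrite -scalerAr -scalerAl.
Qed.

Lemma graded_bound_mmap L (Psi : 'I_L -> B) E (r : {mpoly K[L]}) :
  (forall i, cone_element (Psi i)) -> (msize r <= E.+1)%N ->
  graded_bound E (mmap h Psi r).
Proof.
move=> cone_Psi sz_r.
have monom (m : 'X_{1..L}) : graded_bound (mdeg m) (mmap1 Psi m).
  rewrite mdegE /mmap1; elim/big_rec2: _ => [|i e x _ gx]; first exact: graded_bound1.
  rewrite mulrC addnC; elim: (m i) => [|k IHk]; first by rewrite addn0 expr0 mulr1.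
  by rewrite addnS exprSr mulrA; apply: graded_boundM.
have gm m : m \in msupp r -> graded_bound E (h r@_m * mmap1 Psi m).
  move=> m_r t; rewrite /polyCC /= coefCM mul_mpolyC.
  have le_mE : (mdeg m <= E)%N.
    by rewrite -ltnS (leq_trans _ sz_r) // msize_mdeg_lt.
  have [sm im] := monom m t; split.
    by rewrite (leq_trans (msizeZ_le _ _)) // (leq_trans sm) // ltnS leq_mul2l le_mE orbT.
  move/im => /(bounded_idealZ r@_m); apply: bounded_idealW.
  by rewrite ltnS leq_mul2l le_mE orbT.
rewrite /mmap big_seq; elim/big_rec: _ => [t|m x m_r gx t].
  by rewrite coef0 msize0; split=> // _; apply: bounded_ideal0.
have [s1 i1] := gm m m_r t; have [s2 i2] := gx t.
rewrite coefD; split.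
  by rewrite (leq_trans (msizeD_le _ _)) // geq_max s1 s2.
by move=> t0; apply: bounded_idealD; [apply: i1|apply: i2].
Qed.

(** In [z ^ e + sum_(i < e) c_i z ^ i = 0] with [c_i] a polynomial in the cone
    elements, the coefficient of [z ^ e] in [c_i z ^ i] comes from a positive
    power of [z] in [c_i], hence lies in the ideal.  The coefficient of
    [z ^ e] in [z ^ e] is [1]. *)
Lemma certificate_of_monic L (Psi : 'I_L -> B) E (mu : {poly {mpoly K[L]}}) :
  (forall i, cone_element (Psi i)) -> mu \is monic ->
  (map_poly (mmap h Psi) mu).['X] = 0 -> (forall j, (msize mu`_j <= E.+1)%N) ->
  certificate (d * E).+1 F.
Proof.
move=> cone_Psi monmu muX szmu; set e := (size mu).-1.
have sz_mu : size mu = e.+1.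
  by rewrite prednK // size_poly_gt0 monic_neq0.
have mu_e : mu`_e = 1 by have /monicP := monmu; rewrite lead_coefE.
have relX : \sum_(i < e) mmap h Psi mu`_i * 'X^i + 'X^e = 0.
  rewrite -[RHS]muX -[mu in RHS]coefK poly_def sz_mu big_ord_recr /=.
  rewrite mu_e scale1r rmorphD hornerD /= map_polyXn hornerXn rmorph_sum horner_sum.
  congr (_ + _); apply: eq_bigr => i _ /=.
  by rewrite map_polyZ map_polyXn hornerZ hornerXn.
have := congr1 (fun p : B => p`_e) relX; rewrite /= coef0.
rewrite coefD coefXn eqxx coef_sum => /(canRL (addKr _)); rewrite addr0 => one_eq.
suff [g sg defg] : bounded_ideal (d * E).+1 1 by exists g.
rewrite -[1]/(true%:R) one_eq -sumrN; apply: bounded_ideal_sum => i _.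
rewrite coefMXn ltnNge ltnW //= -scaleN1r; apply: bounded_idealZ.
have [_] := graded_bound_mmap cone_Psi (szmu i) (e - i)%N; apply.
by rewrite subn_gt0.
Qed.

Lemma cone_element_sum n (a : 'I_n -> K) (x : 'I_n -> B) :
  (forall k, cone_element (x k)) -> cone_element (\sum_k h (a k) * x k).
Proof.
move=> cone_x; elim/big_rec: _ => [|k b _ [l [c sl ->]]].
  exists 0, (fun=> 0); first by rewrite msize0.
  by rewrite big1 => [|j _]; rewrite ?scale0r // mul0r addr0.
have [l' [c' sl' ->]] := cone_x k.
exists (a k *: l' + l), (fun j => a k * c' j + c j).
  rewrite (leq_trans (msizeD_le _ _)) // geq_max sl (leq_trans (msizeZ_le _ _)) //.
rewrite mulrDr addrACA -polyCM mul_mpolyC -polyCD; congr (_ + _).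
rewrite mulrA -polyCM mul_mpolyC -mulrDl -polyCD; congr (_%:P * _).
rewrite scaler_sumr -big_split; apply: eq_bigr => j _ /=.
by rewrite scalerDl scalerA.
Qed.

(** The ring [B] is a copy of [{mpoly K[N.+1]}], with ['X] as last variable. *)
Let var (i : 'I_N.+1) : B := muni 'X_i.

Lemma mmap_var r : mmap h var r = muni r.
Proof.
rewrite [in RHS](mpolyE r) /mmap rmorph_sum; apply: eq_bigr => m _ /=.
rewrite muniZ -mul_polyC; congr (_ * _).
by rewrite mpolyXE_id rmorph_prod; apply: eq_bigr => i _; rewrite rmorphXn.
Qed.

Lemma muni_var_max : muni 'X_ord_max = 'X :> B.
Proof.
rewrite muniE msuppX big_seq1 mcoeffX eqxx scale1r mnm1E eqxx.
rewrite (_ : [multinom _ | _ < _] = 0%MM) ?mpolyX0 ?scale1r ?expr1 //.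
by apply/mnmP => i; rewrite mnmE mnm1E -val_eqE /= gtn_eqF // mnm0E.
Qed.

Lemma muni_var_widen i : muni 'X_(widen i) = ('X_i)%:P :> B.
Proof.
rewrite muniE msuppX big_seq1 mcoeffX eqxx scale1r mnm1E -val_eqE /= ltn_eqF //.
rewrite expr0 -mul_polyC mulr1; congr (_%:P); congr 'X_[_].
by apply/mnmP => j; rewrite mnmE !mnm1E.
Qed.

(** Once the degrees of the elements are fixed, the right side of the counting
    inequality of [perron_relation] has the larger power of [m]. *)
Lemma perron_dependence M (y : 'I_M -> B) (w : B) : (N.+1 <= M)%N ->
  exists2 q : {poly {mpoly K[M]}}, q != 0 & (map_poly (mmap h y) q).[w] = 0.
Proof.
move=> lt_NM.
pose y' (i : 'I_M.+1) := if @unlift M.+1 ord_max i is Some k then y k else w.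
have [a0 Ha] := choice (fun i => degree_box_ex (y' i)).
have [d0 bnd] := choice Ha.
pose a := (\max_i a0 i).+1; pose e := (\max_i d0 i).+1.
have bnd' i : degree_box a e (y' i).
  apply: degree_boxW (bnd i).
    by rewrite ltnW // ltnS (leq_bigmax i).
  by rewrite ltnW // ltnS (leq_bigmax i).
pose c1 := (e * M.+1).+1; pose c2 := (a * M.+1).+1.
pose m := (c1 ^ N * c2).+1.
have [i|||q [q0 qyw _]] := @perron_relation K N M y w a e m.
- by have := bnd' (lift ord_max i); rewrite /y' liftK.
- by have := bnd' ord_max; rewrite /y' unlift_none.
- have le_c k c' : (k = c' * M.+1)%N -> ((c' * (M.+1 * m.-1)).+1 <= k.+1 * m)%N.
    by move=> ->; rewrite mulnA /m /=; nia.
  apply: (@leq_ltn_trans ((c1 * m) ^ N * (c2 * m))).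
    apply: leq_mul; last exact: le_c.
    by case: (N) => // n; rewrite leq_exp2r // le_c.
  rewrite expnMn mulnACA -expnSr; apply: (@leq_trans (m ^ N.+2)).
    by rewrite [in X in (_ < X)%N]expnS ltn_mul2r expn_gt0 /= ltnSn.
  by rewrite leq_pexp2l.
by exists q.
Qed.

(** From [1 = sum_j g_j F_j], [z = sum_j g_j (z F_j)] belongs to the algebra
    generated by the [x_i] and the [z F_j].  That the bound does not depend on
    the number of equations comes from the normalization, after which only
    [N + 1] elements are left. *)
Theorem effective_nullstellensatz (g : J -> {mpoly K[N]}) :
  \sum_j g j * F j = 1 -> certificate (nss_bound N d) F.
Proof.
move=> defg.
pose T : finType := ('I_N + J)%type.
pose Y (t : T) : B :=
  match t with inl i => ('X_i)%:P | inr j => (F j)%:P * 'X end.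
have [s card_J] : exists s, #|J| = s.+1.
  case eq_J: #|J| => [|s]; last by exists s.
  have : \sum_j g j * F j = 0 by rewrite big1 // => j _; have := card0_eq eq_J j.
  by rewrite defg => /eqP; rewrite oner_eq0.
have card_T : (s + N.+1)%N = #|T| by rewrite card_sum card_ord card_J; lia.
pose y (k : 'I_(s + N.+1)) := Y (enum_val (cast_ord card_T k)).
have y_onto t : exists k, y k = Y t.
  exists (cast_ord (esym card_T) (enum_rank t)).
  by rewrite /y cast_ordKV enum_rankK.
have cone_y k : cone_element (y k).
  rewrite /y; case: (enum_val _) => [i|j] /=.
    exists 'X_i, (fun=> 0); first by rewrite msizeX mdeg1.
    by rewrite big1 ?mul0r ?addr0 // => j _; rewrite scale0r.
  exists 0, (fun j' => (j' == j)%:R); first by rewrite msize0.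
  have -> : \sum_j' (j' == j)%:R *: F j' = F j.
    rewrite (bigD1 j) //= eqxx scale1r big1 ?addr0 // => j' /negPf->.
    by rewrite scale0r.
  by rewrite polyC0; rewrite add0r.
have gen (R : comNzRingType) (f : {rmorphism R -> B}) :
    (forall c, integralOver f (h c)) -> (forall j, integralOver f (y j)) ->
    forall i, integralOver f (var i).
  move=> int_h int_y.
  have int_x i : integralOver f ('X_i)%:P.
    by have [k eq_k] := y_onto (inl i); have := int_y k; rewrite eq_k.
  apply: ord_widen_ind => [|i]; rewrite /var ?muni_var_widen // muni_var_max.
  have -> : 'X = \sum_j (g j)%:P * ((F j)%:P * 'X) :> B.
    under eq_bigr do rewrite mulrA -polyCM.
    by rewrite -mulr_suml -rmorph_sum defg mul1r.
  elim/big_rec: _ => [|j b _ int_b]; first exact: integral0.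
  apply: integral_add int_b; apply: integral_mul.
    have -> : (g j)%:P = mmap h (fun i => ('X_i)%:P) (g j).
      rewrite {1}(mpolyE (g j)) rmorph_sum; apply: eq_bigr => m _ /=.
      rewrite -mul_mpolyC polyCM; congr (_ * _).
      by rewrite mpolyXE_id rmorph_prod; apply: eq_bigr => i _; rewrite rmorphXn.
    exact: (integral_mmap _ int_h int_x).
  by have [k eq_k] := y_onto (inr j); have := int_y k; rewrite eq_k.
have indep_var r : r != 0 -> mmap h var r != 0.
  by move=> r0; rewrite mmap_var -(raddf0 (@muni N K)) (inj_eq (@muni_inj _ _)).
have [A indep int_x] := noether_independent infK perron_dependence indep_var gen.
have [Psi [cone_Psi {}indep int_X]] : exists Psi : 'I_N.+1 -> B,
    [/\ forall i, cone_element (Psi i), forall b, b != 0 -> mmap h Psi b != 0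
      & integralOver (mmap h Psi) 'X].
  exists (fun i => \sum_j h (A i j) * y j); split=> [i|//|].
    exact: cone_element_sum.
  by rewrite -muni_var_max; apply: int_x.
pose c := ((d * N.+2) ^ N * N.+2)%N.
have box_Psi i : degree_box 1 d (Psi i).
  have [l [c' sl ->]] := cone_Psi i; split.
    rewrite (leq_trans (size_polyD _ _)) // geq_max.
    rewrite (leq_trans (size_polyC_leq1 _)) //= mul_polyC.
    by rewrite (leq_trans (size_scale_leq _ _)) // size_polyX.
  move=> j; rewrite coefD coefC mul_polyC coefZ coefX.
  rewrite (leq_trans (msizeD_le _ _)) // geq_max.
  have -> /= : (msize (if j == 0%N then l else 0%R) <= d.+1)%N.
    by case: ifP; rewrite ?msize0.
  case: eqP => _; last by rewrite mulr0 msize0.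
  rewrite mulr1 (leq_trans (msize_sum _ _ _)) //; apply/bigmax_leqP => j' _.
  by rewrite (leq_trans (msizeZ_le _ _)).
have box_X : degree_box 1 d ('X : B).
  split; first by rewrite size_polyX.
  by move=> j; rewrite coefX; case: eqP => _; rewrite ?msize1 ?msize0.
(* In degree one in [z] and [d] in [x], [m = c + 1] exponents suffice to count. *)
have [|P1 [P10 P1X szP1]] := @perron_relation K N N.+1 Psi 'X 1 d c.+1 box_Psi box_X.
  rewrite /= mul1n; apply: (@leq_ltn_trans ((d * N.+2 * c.+1) ^ N * (N.+2 * c.+1))).
    have le_c : (0 < d * N.+2)%N by rewrite muln_gt0 d_gt0.
    apply: leq_mul; last by rewrite mulnS addSn ltnS leq_addl.
    case: (N) le_c => // n le_c; rewrite leq_exp2r //.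
    rewrite mulnA; move: (d * n.+3)%N le_c => u le_u; rewrite mulnS.
    by move: (u * c)%N => v; lia.
  rewrite expnMn mulnACA -expnSr -/c [X in (_ < X)%N]expnS.
  by rewrite ltn_mul2r expn_gt0 /= ltnSn.
have [mu [monmu muX szmu]] := bounded_monic_relation indep int_X P10 P1X szP1.
by have := certificate_of_monic cone_Psi monmu muX szmu.
Qed.
End EffectiveNullstellensatz.

(** * Certificates as vanishing of minors *)

Section Macaulay.
Variables (N : nat) (J : finType) (D W : nat).

Definition mac_row : finType := (J * 'X_{1..N < D})%type.
Definition mac_col : finType := 'X_{1..N < W}.
Local Notation nrow := #|mac_row|.
Local Notation ncol := #|mac_col|.

(** The row space consists of the coordinates of the [sum_j g_j F_j] with all
    [g_j] of size at most [D]. *)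
Definition macaulay (R : comNzRingType) (F : J -> {mpoly R[N]}) : 'M[R]_(nrow, ncol) :=
  \matrix_(r < nrow, c < ncol)
    ('X_[(enum_val r : mac_row).2] * F (enum_val r : mac_row).1)@_(enum_val c : mac_col).

Definition unit_row (R : comNzRingType) : 'rV[R]_ncol :=
  \row_(c < ncol) (1 : {mpoly R[N]})@_(enum_val c : mac_col).

Definition augmented (R : comNzRingType) (F : J -> {mpoly R[N]}) :=
  col_mx (macaulay F) (unit_row R).

Lemma map_macaulay (R S : comNzRingType) (phi : {rmorphism R -> S})
    (F : J -> {mpoly R[N]}) :
  map_mx phi (macaulay F) = macaulay (fun j => map_mpoly phi (F j)).
Proof.
apply/matrixP => r c; rewrite !mxE -mcoeff_map_mpoly rmorphM /=.
by rewrite map_mpolyX.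
Qed.

Lemma map_augmented (R S : comNzRingType) (phi : {rmorphism R -> S})
    (F : J -> {mpoly R[N]}) :
  map_mx phi (augmented F) = augmented (fun j => map_mpoly phi (F j)).
Proof.
rewrite /augmented map_col_mx map_macaulay; congr col_mx.
by apply/matrixP => r c; rewrite !mxE !mcoeff1 rmorph_nat.
Qed.

Lemma macaulay_entry (R : comNzRingType) (F : J -> {mpoly R[N]}) (P : R -> Prop) :
  P 0 -> (forall j m, P (F j)@_m) -> forall r c, P (macaulay F r c).
Proof.
move=> P0 PF r c; rewrite mxE.
set a := enum_val r; set m := (enum_val c : 'X_{1..N < W}).
have [le_am|le_am] := boolP ((a.2 : 'X_{1..N}) <= m)%MM.
  by rewrite -(submK le_am) addmC mulrC mcoeffMX.
rewrite memN_msupp_eq0 //; apply: contra le_am; rewrite mulrC (perm_mem (msuppMX _ _)).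
by case/mapP => m' _ ->; apply/mnm_lepP => i; rewrite mnmDE leq_addr.
Qed.

Lemma augmented_entry (R : comNzRingType) (F : J -> {mpoly R[N]}) (P : R -> Prop) :
  P 0 -> P 1 -> (forall j m, P (F j)@_m) -> forall r c, P (augmented F r c).
Proof.
move=> P0 P1 PF r c; rewrite mxE; case: splitP => k _; first exact: macaulay_entry.
by rewrite mxE mcoeff1; case: eqP.
Qed.

Lemma certificateP (K : fieldType) (F : J -> {mpoly K[N]}) d : (0 < W)%N ->
    (D + d <= W)%N -> (forall j, (msize (F j) <= d.+1)%N) ->
  reflect (certificate D F) (unit_row K <= macaulay F)%MS.
Proof.
move=> W_gt0 le_W szF; apply: (iffP submxP) => [[u def_u] | [g sg defg]].
  exists (fun j => \sum_(a : 'X_{1..N < D}) u 0 (enum_rank (j, a)) *: 'X_[a]).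
    move=> j; rewrite (leq_trans (msize_sum _ _ _)) //; apply/bigmax_leqP => a _.
    by rewrite (leq_trans (msizeZ_le _ _)) // msizeX bmdeg.
  apply/mpolyP => m.
  under eq_bigr do rewrite mulr_suml.
  rewrite pair_bigA raddf_sum /=.
  have [lt_m|le_m] := ltnP (mdeg m) W; last first.
    rewrite mcoeff1; case: eqP => [m0|_].
      by move: le_m; rewrite m0 mdeg0 leqNgt W_gt0.
    apply: big1 => -[j a] _ /=; rewrite memN_msupp_eq0 //.
    apply/msize_mdeg_ge/(leq_trans _ le_m)/(leq_trans _ le_W).
    rewrite -scalerAl (leq_trans (msizeZ_le _ _)) //.
    rewrite (leq_trans (msizeM_leq _ _)) // msizeX -subn1 leq_subLR add1n -addnS.
    by rewrite leq_add ?bmdeg.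
  have /matrixP/(_ 0 (enum_rank (BMultinom lt_m))) := def_u.
  rewrite !mxE enum_rankK /= => ->.
  rewrite (reindex (@enum_rank _)) /=; last first.
    by exists enum_val => ? _; rewrite ?enum_valK ?enum_rankK.
  apply: eq_bigr => -[j a] _ /=; rewrite mxE !enum_rankK /=.
  by rewrite -scalerAl mcoeffZ.
exists (\row_(r < nrow) (g (enum_val r : mac_row).1)@_((enum_val r : mac_row).2)).
apply/matrixP => i c; rewrite !mxE -defg raddf_sum /=.
rewrite (reindex (@enum_rank mac_row)) /=; last first.
  by exists enum_val => ? _; rewrite ?enum_valK ?enum_rankK.
transitivity (\sum_j \sum_(a : 'X_{1..N < D}) (g j)@_a * ('X_[a] * F j)@_(enum_val c : mac_col)).
  apply: eq_bigr => j _; rewrite {1}(mpolywE (sg j)) mulr_suml raddf_sum /=.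
  by apply: eq_bigr => a _; rewrite -scalerAl mcoeffZ.
rewrite pair_bigA /=; apply: eq_bigr => -[j a] _.
by rewrite !mxE !enum_rankK.
Qed.

(** No certificate means that the row of [1] raises the rank of the Macaulay
    matrix.  Stated for a morphism [phi], so that one matrix over [R] (the
    integers, or polynomials in a parameter) serves for all its
    specializations. *)
Lemma no_certificateP (R : comNzRingType) (K : fieldType) (phi : {rmorphism R -> K})
    (F : J -> {mpoly R[N]}) d : (0 < W)%N ->
    (D + d <= W)%N -> (forall j, (msize (F j) <= d.+1)%N) ->
  ~ certificate D (fun j => map_mpoly phi (F j)) <->
  exists2 t, (t <= ncol)%N &
    (exists f : 'I_t -> 'I_(nrow + 1), exists g : 'I_t -> 'I_ncol,
       phi (\det (mxsub f g (augmented F))) != 0)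
    /\ forall (f : 'I_t -> 'I_nrow) (g : 'I_t -> 'I_ncol),
         phi (\det (mxsub f g (macaulay F))) = 0.
Proof.
move=> W_gt0 le_W szF.
have szF' j : (msize (map_mpoly phi (F j)) <= d.+1)%N.
  exact: leq_trans (msize_map_mpoly _ _) (szF j).
have minor t m n (f : 'I_t -> 'I_m) (g : 'I_t -> 'I_n) (A : 'M[R]_(m, n)) :
    phi (\det (mxsub f g A)) = \det (mxsub f g (map_mx phi A)).
  by rewrite -det_map_mx map_mxsub.
set G := fun j => _.
have certE : certificate D G <-> (\rank (augmented G) <= \rank (macaulay G))%N.
  apply: (iff_trans (rwP (certificateP W_gt0 le_W szF'))); rewrite /augmented -addsmxE.
  split=> [le_u|].
    by rewrite mxrankS // addsmx_sub submx_refl.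
  have := mxrank_leqif_sup (addsmxSl (macaulay G) (unit_row K)).
  move=> [le_r eq_r] le_r'.
  have := eqn_leq (\rank (macaulay G)) (\rank (macaulay G + unit_row K)%MS).
  by rewrite le_r le_r' eq_r => /(submx_trans (addsmxSr _ _)).
rewrite certE; split=> [/negP|[t _ [[f [g fg0]] all0]]].
  rewrite -ltnNge => lt_r; exists (\rank (augmented G)); first exact: rank_leq_col.
  split.
    have /rank_minorP[f [g fg]] := leqnn (\rank (augmented G)).
    by exists f, g; rewrite minor map_augmented.
  move=> f g; apply/eqP/negPn/negP; rewrite minor map_macaulay => fg0.
  move: lt_r; rewrite ltnNge => /negP; apply.
  by apply/rank_minorP; exists f, g.
move=> le_r; have : (t <= \rank (augmented G))%N.
  by apply/rank_minorP; exists f, g; rewrite -map_augmented -minor.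
move/leq_trans/(_ le_r)/rank_minorP => [f' [g']].
by rewrite -map_macaulay -minor all0 eqxx.
Qed.

Lemma card_mac_col : (ncol <= W ^ N)%N.
Proof.
have lt_m (m : mac_col) i : ((m : 'X_{1..N}) i < W)%N.
  by rewrite (leq_ltn_trans _ (bmdeg m)) // mdegE (bigD1 i) //= leq_addr.
pose e (m : mac_col) : {ffun 'I_N -> 'I_W} := [ffun i => Ordinal (lt_m m i)].
have inj_e : injective e.
  move=> m m' /ffunP eq_e; apply: val_inj; apply/mnmP => i.
  by have /(congr1 val) := eq_e i; rewrite !ffunE.
by have := leq_card e inj_e; rewrite card_ffun !card_ord.
Qed.
End Macaulay.

Lemma intr_eq0_absz (K : fieldType) (z : int) :
  (z%:~R == 0 :> K) = (`|z|%N%:R == 0 :> K).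
Proof.
case: z => n; first by rewrite -pmulrn.
by rewrite NegzE mulrNz oppr_eq0 -pmulrn abszN.
Qed.

Lemma intr_eq0_pchar (K : fieldType) p (z : int) : p \in [pchar K] ->
  (z%:~R == 0 :> K) = (p %| `|z|)%N.
Proof. by move=> charK; rewrite intr_eq0_absz (dvdn_pcharf charK). Qed.

Lemma intr_pchar_eq (K K' : fieldType) p (z : int) :
  p \in [pchar K] -> p \in [pchar K'] -> (z%:~R == 0 :> K) = (z%:~R == 0 :> K').
Proof. by move=> cK cK'; rewrite (intr_eq0_pchar _ cK) (intr_eq0_pchar _ cK'). Qed.

Lemma det_int_bound t (A : 'M[int]_t) H :
  (forall i j, `|A i j| <= H)%N -> (`|\det A| <= t`! * H ^ t)%N.
Proof.
move=> bndA; rewrite -lez_nat abszE /determinant.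
apply: (le_trans (ler_norm_sum _ _ _)).
have -> : Posz (t`! * H ^ t) = \sum_(s : {perm 'I_t}) Posz (H ^ t).
  by rewrite sumr_const card_Sn PoszM -mulr_natl natz.
apply: ler_sum => s _.
rewrite normrM normrX normrN1 expr1n mul1r normr_prod.
rewrite -[X in _ <= X](_ : \prod_(i < t) (H%:Z) = _); last first.
  by rewrite prodr_const card_ord -[H%:Z]natz -natrX natz.
apply: ler_prod => i _; rewrite normr_ge0 -abszE lez_nat.
exact: bndA.
Qed.

Section Transfer.
Variables (N : nat) (J : finType) (F : J -> {mpoly int[N]}) (D d H : nat).
Hypotheses (D_gt0 : (0 < D)%N) (H_gt0 : (0 < H)%N).
Hypothesis szF : forall j, (msize (F j) <= d.+1)%N.
Local Notation over K := (fun j => map_mpoly (intr : int -> K) (F j)).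
Let W := (D + d)%N.
Let W_gt0 : (0 < W)%N. Proof. by rewrite addn_gt0 D_gt0. Qed.

(** The minors are integers, and which of them vanish depends only on the
    characteristic. *)
Lemma certificate_same_pchar (K K' : fieldType) p :
  p \in [pchar K] -> p \in [pchar K'] ->
  ~ certificate D (over K) -> ~ certificate D (over K').
Proof.
move=> cK cK' /(no_certificateP (intr : {rmorphism int -> K}) W_gt0 (leqnn _) szF).
move=> [t le_t [[f [g fg0]] all0]].
apply/(no_certificateP (intr : {rmorphism int -> K'}) W_gt0 (leqnn _) szF).
exists t => //; split; first by exists f, g; rewrite -(intr_pchar_eq _ cK cK').
by move=> f' g'; apply/eqP; rewrite -(intr_pchar_eq _ cK cK'); apply/eqP/all0.
Qed.

Hypothesis coefF : forall j m, (`|(F j)@_m| <= H)%N.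

(** If the characteristic of [K] is zero or large, the minors that vanish in
    [K] are zero as integers; it remains to find a small prime that does not
    divide the nonzero minor [z]. *)
Lemma certificate_transfer (K : fieldType) : ~ certificate D (over K) ->
  exists p, [/\ prime p, (p <= ((W ^ N)`! * H ^ (W ^ N)).+1)%N &
    forall K' : fieldType, p \in [pchar K'] -> ~ certificate D (over K')].
Proof.
move=> noK; set bnd := (_ * _)%N.
have [[p [cK le_p]] | big] :=
    pselect (exists p, p \in [pchar K] /\ (p <= bnd.+1)%N).
  exists p; split=> [||K' cK'] //; first exact: pcharf_prime cK.
  exact: certificate_same_pchar cK cK' noK.
move/(no_certificateP (intr : {rmorphism int -> K}) W_gt0 (leqnn _) szF): noK.
move=> [t le_t [[f [g fg0]] all0]].
have bndX m n (A : 'M[int]_(m, n)) (f' : 'I_t -> 'I_m) (g' : 'I_t -> 'I_n) :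
    (forall i j, `|A i j| <= H)%N -> (`|\det (mxsub f' g' A)| <= bnd)%N.
  move=> bndA; apply: leq_trans (det_int_bound (H := H) _) _ => [i j|].
    by rewrite mxE.
  have le_tW := leq_trans le_t (card_mac_col N W).
  by rewrite /bnd leq_mul ?leq_fact ?leq_pexp2l.
have bndM r c : (`|macaulay D W F r c| <= H)%N.
  by apply: (macaulay_entry (P := fun z : int => (`|z| <= H)%N)).
have all0Z (f' : 'I_t -> _) g' : \det (mxsub f' g' (macaulay D W F)) = 0 :> int.
  have := all0 f' g'; have := bndX _ _ _ f' g' bndM.
  move: (\det _) => z le_z /eqP z0; apply/eqP; rewrite -absz_eq0.
  have [[p cK]|char0] := pselect (exists p, p \in [pchar K]).
    rewrite [_ == 0](intr_eq0_pchar _ cK) in z0.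
    rewrite -leqn0 leqNgt; apply/negP => z_gt0; apply: big; exists p; split=> //.
    by rewrite (leq_trans (dvdn_leq z_gt0 z0)) // ltnW // ltnS.
  have /pcharf0P char0' : [pchar K] =i pred0.
    by move=> p; apply/negP => cK; apply: char0; exists p.
  by rewrite [_ == 0]intr_eq0_absz char0' in z0.
set z := \det _ in fg0.
have le_z : (`|z| <= bnd)%N.
  by apply: bndX; apply: (augmented_entry (P := fun z : int => (`|z| <= H)%N)).
have z_gt0 : (0 < `|z|)%N.
  by rewrite absz_gt0; apply: contraNneq fg0 => ->; rewrite rmorph0.
(* A prime divisor of [|z| + 1] is at most [bnd + 1] and does not divide [z]. *)
have pr_p : prime (pdiv `|z|.+1) by rewrite pdiv_prime.
exists (pdiv `|z|.+1); split=> // [|K' cK'].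
  by rewrite (leq_trans (dvdn_leq _ (pdiv_dvd _))).
apply/(no_certificateP (intr : {rmorphism int -> K'}) W_gt0 (leqnn _) szF).
exists t => //; split; last by move=> f' g'; rewrite all0Z rmorph0.
exists f, g; rewrite -/z [_ == 0](intr_eq0_pchar _ cK'); apply/negP => dvd_z.
have := pdiv_dvd `|z|.+1; rewrite -{2}addn1 (dvdn_addr _ dvd_z) => /dvdn_leq.
by move/(_ isT); rewrite leqNgt prime_gt1 // addn1.
Qed.
End Transfer.

(** * Prescribing the value of one variable *)

(** The roots of [1 + X * prod_(z <- s) (X - z)] lie outside [s]. *)
Lemma closed_field_infinite (K : closedFieldType) : infinite_type K.
Proof.
move=> s; pose p : {poly K} := 1 + \prod_(z <- s) ('X - z%:P) * 'X.
have szp : (1 < size p)%N.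
  have nz : \prod_(z <- s) ('X - z%:P) != 0 by rewrite monic_neq0 ?monic_prod_XsubC.
  by rewrite /p addrC size_polyDl size_mulX // ?size_poly1 ltnS size_poly_gt0.
have /closed_rootP[x /rootP px] : size p != 1%N by rewrite neq_ltn szp orbT.
exists x; apply/negP => sx; move: px.
rewrite /p hornerD hornerM hornerC (rootP (_ : root _ x)) ?root_prod_XsubC //.
by rewrite mul0r addr0 => /eqP; rewrite oner_eq0.
Qed.

Lemma sum_option (V : nmodType) (J : finType) (f : option J -> V) :
  \sum_o f o = f None + \sum_j f (Some j).
Proof.
rewrite (bigD1 None) //=; congr (_ + _).
rewrite (reindex_omap Some id) /=; last by case.
by apply: eq_bigl => j; rewrite eqxx.
Qed.

Section Ideal.
Variables (R : comNzRingType) (J : finType) (F : J -> R).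

Definition in_ideal p := exists g : J -> R, \sum_j g j * F j = p.

Lemma in_ideal_gen j : in_ideal (F j).
Proof.
exists (fun k => (k == j)%:R); rewrite (bigD1 j) //= eqxx mul1r big1 ?addr0 //.
by move=> k /negPf->; rewrite mul0r.
Qed.

Lemma in_ideal0 : in_ideal 0.
Proof. by exists (fun=> 0); rewrite big1 // => j _; rewrite mul0r. Qed.

Lemma in_idealD p q : in_ideal p -> in_ideal q -> in_ideal (p + q).
Proof.
move=> [g <-] [g' <-]; exists (fun j => g j + g' j).
by rewrite -big_split; apply: eq_bigr => j _; rewrite mulrDl.
Qed.

Lemma in_idealM p q : in_ideal q -> in_ideal (p * q).
Proof.
move=> [g <-]; exists (fun j => p * g j).
by rewrite mulr_sumr; apply: eq_bigr => j _; rewrite mulrA.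
Qed.

Lemma in_ideal_sum (I : finType) (p : I -> R) :
  (forall i, in_ideal (p i)) -> in_ideal (\sum_i p i).
Proof.
move=> ip; elim/big_rec: _ => [|i q _ iq]; first exact: in_ideal0.
exact: in_idealD.
Qed.
End Ideal.

Lemma in_ideal_sub (R : comNzRingType) (J J' : finType) (F : J -> R) (F' : J' -> R) p :
  (forall j, in_ideal F' (F j)) -> in_ideal F p -> in_ideal F' p.
Proof.
by move=> sub [g <-]; apply: in_ideal_sum => j; apply: in_idealM.
Qed.

Definition consistent (R : comNzRingType) (J : finType) (F : J -> R) :=
  ~ in_ideal F 1.

Section AddPoint.
Variables (R : comNzRingType) (N : nat) (J : finType) (F : J -> {mpoly R[N]}).

Definition add_root (i : 'I_N) (a : R) (o : option J) : {mpoly R[N]} :=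
  if o is Some j then F j else 'X_i - a%:MP.

End AddPoint.

Lemma fraction_denominator (S : idomainType) (x : {fraction S}) :
  exists2 c : S, c != 0 & exists s, tofrac c * x = tofrac s.
Proof.
elim/quotW: x => r; exists \d_r; first exact: denom_ratioP.
exists \n_r; unlock tofrac; rewrite -[LHS]FracField.pi_mul.
apply/eqmodP; rewrite /= FracField.equivfE /FracField.mulf.
by rewrite !numden_Ratio ?(oner_neq0, mul1r, mulr1, denom_ratioP) // mulrC.
Qed.

(** The degree bound makes the set of coefficients finite, so that they
    have a common denominator. *)
Lemma clear_denominators (S : idomainType) N (J : finType) D
    (g : J -> {mpoly {fraction S}[N]}) : (forall j, (msize (g j) <= D)%N) ->
  exists2 c : S, c != 0 &
    exists G : J -> {mpoly S[N]}, forall j, map_mpoly (@tofrac S) (G j) = tofrac c *: g j.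
Proof.
move=> sg; pose x (i : J * 'X_{1..N < D}) := (g i.1)@_i.2.
have [i|den denP] := choice (P := fun i c => c != 0 /\
    exists s, tofrac c * x i = tofrac s).
  by have [c c0 cP] := fraction_denominator (x i); exists c.
exists (\prod_i den i); first by apply/prodf_neq0 => i _; have [] := denP i.
have [i|s sP] := choice (P := fun i s => tofrac (\prod_i den i) * x i = tofrac s).
  have [_ [s sP]] := denP i; exists (s * \prod_(k | k != i) den k).
  by rewrite (bigD1 i) //= rmorphM mulrAC sP rmorphM.
exists (fun j => \sum_(a : 'X_{1..N < D}) s (j, a) *: 'X_[a]) => j.
rewrite [in RHS](mpolywE (sg j)) scaler_sumr rmorph_sum; apply: eq_bigr => a _ /=.
by rewrite map_mpolyZ map_mpolyX scalerA; congr (_ *: _); rewrite (sP (j, a)).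
Qed.

Section WeakNullstellensatz.
Variables (K : closedFieldType) (N : nat).

(** The degree bound turns consistency into a condition on finitely many minors. *)
Lemma nullstellensatz_certificate (J : finType) (F : J -> {mpoly K[N]}) d :
  (0 < d)%N -> (forall j, (msize (F j) <= d.+1)%N) ->
  consistent F <-> ~ certificate (nss_bound N d) F.
Proof.
move=> d_gt0 szF; split=> consF; apply: contra_not consF.
  by move=> [g _ gF]; exists g.
move=> [g gF].
exact: (effective_nullstellensatz (@closed_field_infinite K) d_gt0 szF gF).
Qed.

Variables (J : finType) (F : J -> {mpoly K[N]}) (d : nat).
Hypotheses (d_gt0 : (0 < d)%N) (szF : forall j, (msize (F j) <= d.+1)%N).

(** The minors of this system are polynomials in the parameter; their values at
    [a] are the minors of [add_root F i a]. *)
Definition generic_root (i : 'I_N) : option J -> {mpoly {poly K}[N]} :=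
  add_root (fun j => map_mpoly polyC (F j)) i 'X.

Lemma size_add_root i a o : (msize (add_root F i a o) <= d.+1)%N.
Proof.
case: o => [j|] //=; rewrite (leq_trans (msizeD_le _ _)) // msizeN msizeC.
by rewrite msizeX mdeg1 geq_max ltnS d_gt0 (leq_trans (leq_b1 _)).
Qed.

Lemma size_generic_root i o : (msize (generic_root i o) <= d.+1)%N.
Proof.
case: o => [j|] /=; first exact: leq_trans (msize_map_mpoly _ _) (szF j).
rewrite (leq_trans (msizeD_le _ _)) // msizeN msizeC msizeX mdeg1 geq_max.
by rewrite ltnS d_gt0 (leq_trans (leq_b1 _)).
Qed.

Lemma generic_root_eval i a o :
  map_mpoly (horner_eval a) (generic_root i o) = add_root F i a o.
Proof.
case: o => [j|] /=.
  by apply/mpolyP => m; rewrite !mcoeff_map_mpoly /= horner_evalE hornerC.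
rewrite rmorphB /= map_mpolyX map_mpolyC /= horner_evalE hornerX.
by [].
Qed.

Lemma consistent_add_rootP i a : consistent (add_root F i a) <->
  ~ certificate (nss_bound N d) (fun o => map_mpoly (horner_eval a) (generic_root i o)).
Proof.
have -> : (fun o => map_mpoly (horner_eval a) (generic_root i o)) = add_root F i a.
  by apply: funext => o; rewrite generic_root_eval.
exact: nullstellensatz_certificate (size_add_root i a).
Qed.

(** If [1] belongs to the ideal generated by [F] and [X_i - a], then [q] belongs
    to the one generated by [q * F] and [q * (X_i - a)]. *)
Lemma in_ideal_factor_root i (a : K) q :
  ~ consistent (add_root F i a) -> in_ideal F (q * ('X_i - a%:MP)) -> in_ideal F q.
Proof.
move/contrapT => [g defg] Iq; rewrite -[q]mulr1 -defg.
rewrite sum_option mulrDr; apply: in_idealD.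
  by rewrite mulrCA; apply: in_idealM.
rewrite mulr_sumr; apply: in_ideal_sum => j; do 2!apply: in_idealM.
exact: in_ideal_gen.
Qed.

(** If every value [a] were excluded, all the systems [add_root F i a] would
    have certificates of a common size, hence so would the generic one, over
    the field of rational functions.  Clearing denominators and substituting
    ['X_i] for the parameter gives a nonzero polynomial in ['X_i] in the ideal
    of [F].  Its linear factors can be removed one by one, as their roots are
    excluded, until [1] is in the ideal. *)
Lemma consistent_add_root i : consistent F -> exists a, consistent (add_root F i a).
Proof.
move=> consF; apply: contrapT => none.
have D_gt0 : (0 < nss_bound N d + d)%N by [].
pose L := {fraction {poly K}}; pose phi : {rmorphism {poly K} -> L} := @tofrac _.
have [g sg defg] : certificate (nss_bound N d) (fun o => map_mpoly phi (generic_root i o)).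
  apply: contrapT => /(no_certificateP phi D_gt0 (leqnn _) (size_generic_root i)).
  move=> [t le_t [[f [g fg0]] all0]].
  have [a da] : exists a, (\det (mxsub f g (augmented (nss_bound N d)
     (nss_bound N d + d) (generic_root i)))).[a] != 0.
    apply: poly_nonroot; first exact: closed_field_infinite.
    by apply: contraNneq fg0 => ->; rewrite rmorph0.
  apply: none; exists a; apply/consistent_add_rootP.
  apply/(no_certificateP (horner_eval a) D_gt0 (leqnn _) (size_generic_root i)).
  exists t => //.
  split; first by exists f, g.
  move=> f' g'; have /eqP := all0 f' g'; rewrite tofrac_eq0 => /eqP->.
  exact: rmorph0.
have [c c0 [G defG]] := clear_denominators sg.
pose ev : {rmorphism {poly K} -> {mpoly K[N]}} :=
  horner_eval 'X_i \o map_poly (@mpolyC N K).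
pose psi := mmap ev (fun k : 'I_N => 'X_k).
have psiM p q : psi (p * q) = psi p * psi q by exact: rmorphM.
have psi_gen o : psi (generic_root i o) = if o is Some j then F j else 0.
  case: o => [j|] /=.
    rewrite /psi [in RHS](mpolyE (F j)) [X in map_mpoly _ X](mpolyE (F j)).
    rewrite (raddf_sum (map_mpoly (@polyC K))) (raddf_sum (mmap ev _)).
    apply: eq_bigr => m _ /=; rewrite map_mpolyZ map_mpolyX mmapZ mmapX mmap1_id /=.
    by rewrite map_polyC horner_evalE hornerC mul_mpolyC.
  rewrite /psi rmorphB /= mmapX mmap1U mmapC /= map_polyX horner_evalE hornerX.
  exact: subrr.
have in_c : in_ideal F (map_poly (@mpolyC N K) c).['X_i].
  exists (fun j => psi (G (Some j))).
  have : \sum_o G o * generic_root i o = c%:MP.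
    suff eqM : map_mpoly phi (\sum_o G o * generic_root i o) = map_mpoly phi c%:MP.
      apply: (map_mpoly_inj (h := phi)) eqM => x y /eqP.
      by rewrite tofrac_eq => /eqP.
    rewrite map_mpolyC rmorph_sum /= -[(tofrac c)%:MP]mulr1 -defg mulr_sumr.
    by apply: eq_bigr => o _; rewrite rmorphM /= defG mul_mpolyC scalerAl.
  move/(congr1 psi); rewrite [psi _%:MP]mmapC /= horner_evalE => <-.
  rewrite [RHS](raddf_sum (mmap ev _)) sum_option.
  rewrite [X in _ = X + _]psiM psi_gen mulr0 add0r.
  by apply: eq_bigr => j _; rewrite [RHS]psiM psi_gen.
apply: consF.
have [s defc] := closed_field_poly_normal c.
have in_prod : in_ideal F (\prod_(z <- s) ('X_i - z%:MP)).
  have -> : \prod_(z <- s) ('X_i - z%:MP) =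
      (lead_coef c)^-1%:MP * (map_poly (@mpolyC N K) c).['X_i].
    rewrite [X in map_poly _ X]defc map_polyZ hornerZ mulrA -mpolyCM mulVf ?lead_coef_eq0 //.
    rewrite mpolyC1 mul1r rmorph_prod horner_prod; apply: eq_bigr => z _.
    by rewrite rmorphB /= map_polyX map_polyC hornerXsubC.
  exact: in_idealM.
elim: s in_prod {defc} => [|z s IHs]; first by rewrite big_nil.
rewrite big_cons mulrC => /in_ideal_factor_root-/(_ (fun c => none (ex_intro _ z c))).
exact: IHs.
Qed.
End WeakNullstellensatz.

(** * Values of bounded degree over the prime field *)

Lemma iter_frobenius (K : fieldType) p k : p \in [pchar K] ->
  exists phi : {rmorphism K -> K}, forall x, phi x = x ^+ (p ^ k).
Proof.
move=> charK; elim: k => [|k [phi phiE]].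
  by exists idfun => x; rewrite expn0 expr1.
exists (pFrobenius_aut charK \o phi) => x /=.
by rewrite phiE pFrobenius_autE -exprM -expnSr.
Qed.

Lemma size_det_affine (K : fieldType) t (A : 'M[{poly K}]_t) :
  (forall i j, (size (A i j) <= 2)%N) -> (size (\det A) <= t.+1)%N.
Proof.
move=> szA; rewrite /determinant (leq_trans (size_sum _ _ _)) //.
apply/bigmax_leqP => s _; rewrite mulr_sign.
rewrite (fun_if (fun q : {poly K} => size q)) size_polyN if_same.
rewrite (leq_trans (size_poly_prod_leq _ _)) // card_ord leq_subLR addnS ltnS.
rewrite (leq_trans (leq_sum _ (fun i _ => szA i (s i)))) //.
by rewrite sum_nat_const card_ord muln2 addnn.
Qed.

(** There are [p ^ Q - 1] distinct roots of unity of that order, more than the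
    roots of [q]. *)
Lemma roots_of_unity_nonroot (K : closedFieldType) p Q (q : {poly K}) :
  p \in [pchar K] -> (0 < Q)%N -> q != 0 -> (size q < p ^ Q)%N ->
  exists2 a, a ^+ (p ^ Q) = a & q.[a] != 0.
Proof.
move=> charK Q_gt0 q0 szq.
have p_gt1 : (1 < p)%N := prime_gt1 (pcharf_prime charK).
set n := (p ^ Q).-1.
have pQ : (p ^ Q)%N = n.+1 by rewrite prednK // expn_gt0 ltnW.
have n_neq0 : n%:R != 0 :> K.
  have : n.+1%:R = 0 :> K.
    by apply/eqP; rewrite -pQ -(dvdn_pcharf charK) dvdn_exp.
  rewrite -natr1 => /eqP; rewrite addr_eq0 => /eqP->.
  by rewrite oppr_eq0 oner_eq0.
have n_gt0 : (0 < n)%N by rewrite lt0n; apply: contraNneq n_neq0 => ->.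
have [s defs] := closed_field_poly_normal ('X^n - 1 : {poly K}).
rewrite (monicP (monicXnsubC _ n_gt0)) scale1r in defs.
have us : uniq s by rewrite -separable_prod_XsubC -defs separable_Xn_sub_1.
have szs : size s = n.
  by apply: succn_inj; rewrite -(size_prod_XsubC s id) -defs size_XnsubC.
have [all_root|/allPn[a sa qa]] := boolP (all (root q) s).
  have := max_poly_roots q0 all_root us; rewrite szs => lt_n.
  by move: szq; rewrite pQ ltnS leqNgt lt_n.
exists a => //; rewrite pQ exprS.
have : root ('X^n - 1) a by rewrite defs root_prod_XsubC.
rewrite /root hornerD hornerN hornerXn hornerC subr_eq0 => /eqP->.
by rewrite mulr1.
Qed.

Section BoundedStep.
Variables (K : closedFieldType) (N : nat) (J : finType) (F : J -> {mpoly K[N]}).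
Variables (d : nat).
Hypotheses (d_gt0 : (0 < d)%N) (szF : forall j, (msize (F j) <= d.+1)%N).

(** An upper bound for the number of columns of the Macaulay matrix, hence for
    the order of its minors. *)
Definition nss_size := ((nss_bound N d + d) ^ N)%N.

(** Let [a0] be an admissible value, and take the order [t] at which the minors
    show its admissibility; as polynomials in the value, minors have degree at
    most [nss_size], and their coefficients are fixed by the [k]-th iterate
    [phi] of Frobenius.  Either some Macaulay minor [q] of this order is not
    identically zero; then it vanishes at [a0] and at all its conjugates, so
    that [a0] has a short orbit under [phi].  Or these minors are all
    identically zero; then any value at which the augmented minor does not
    vanish is admissible, and one is found among roots of unity. *)
Lemma bounded_add_root i p k : p \in [pchar K] -> (0 < k)%N ->
    (forall j m, (F j)@_m ^+ (p ^ k) = (F j)@_m) -> consistent F ->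
  exists a t, [/\ (0 < t <= nss_size.+1)%N, a ^+ (p ^ (k * t)) = a &
    consistent (add_root F i a)].
Proof.
move=> charK k_gt0 fixF consF.
have p_gt1 : (1 < p)%N := prime_gt1 (pcharf_prime charK).
have [a0 cons_a0] := consistent_add_root d_gt0 szF i consF.
have /(consistent_add_rootP d_gt0 szF) no_a0 := cons_a0.
have D_gt0 : (0 < nss_bound N d + d)%N by [].
have [phi phiE] := iter_frobenius k charK.
have iter_phi n x : iter n phi x = x ^+ (p ^ (k * n)).
  elim: n => [|n IHn]; first by rewrite muln0 expn0 expr1.
  by rewrite iterS IHn phiE -exprM -expnD mulnS addnC.
move/(no_certificateP (horner_eval a0) D_gt0 (leqnn _)
        (size_generic_root d_gt0 szF i)): no_a0.
move=> [t le_t [[f [g fg0]] all0]].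
have le_tS : (t <= nss_size)%N := leq_trans le_t (card_mac_col _ _).
have coef_generic o m : (size (generic_root F i o)@_m <= 2)%N /\
    map_poly phi (generic_root F i o)@_m = (generic_root F i o)@_m.
  case: o => [j|] /=.
    rewrite mcoeff_map_mpoly (leq_trans (size_polyC_leq1 _)) //.
    by rewrite map_polyC /= phiE fixF.
  rewrite mcoeffB mcoeffX mcoeffC rmorphB rmorphM !rmorph_nat /= map_polyX.
  split=> //; rewrite (leq_trans (size_polyD _ _)) // size_polyN geq_max.
  case: eqP => _; case: eqP => _;
    by rewrite ?mulr1 ?mulr0 ?size_polyX ?size_poly0 ?size_poly1.
have [|all0P] := pselect (exists f' : 'I_t -> _, exists g', \det (mxsub f' g'
    (macaulay (nss_bound N d) (nss_bound N d + d) (generic_root F i))) != 0).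
  move=> [f' [g']]; have := all0 f' g'; set q := \det _ => qa0 q0.
  have szq : (size q <= nss_size.+1)%N.
    apply: leq_trans (_ : t.+1 <= _)%N => //; apply: size_det_affine => r c.
    rewrite mxE; apply: (macaulay_entry (P := fun z : {poly K} => (size z <= 2)%N)).
      by rewrite size_poly0.
    by move=> o m; have [] := coef_generic o m.
  have fixq : map_poly phi q = q.
    rewrite -det_map_mx; congr (\det _); apply/matrixP => r c; rewrite mxE [in LHS]mxE [RHS]mxE.
    apply: (macaulay_entry (P := fun z : {poly K} => map_poly phi z = z)).
      exact: rmorph0.
    by move=> o m; have [] := coef_generic o m.
  have root_iter n : root q (iter n phi a0).
    elim: n => [|n /rootP IHn]; first by apply/eqP; exact: qa0.
    by rewrite iterS -fixq /root horner_map IHn rmorph0.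
  have loops : looping phi a0 nss_size.
    apply: contraT; rewrite -looping_uniq => us.
    have : all (root q) (traject phi a0 nss_size.+1).
      by apply/allP => _ /trajectP[n _ ->].
    move/(max_poly_roots q0)/(_ us); rewrite size_traject => lt_q.
    by have := leq_trans lt_q szq; rewrite ltnn.
  have /trajectP[n lt_n eq_n] := loops.
  exists a0, (nss_size - n)%N; split; last exact: cons_a0.
    by rewrite subn_gt0 lt_n (leq_trans (leq_subr _ _)).
  rewrite -iter_phi; have iter_inj m : injective (iter m phi).
    by elim: m => [//|m IHm] x y /= /fmorph_inj /IHm.
  by apply: (iter_inj n); rewrite -iterD subnKC // ltnW.
have minors0 (f' : 'I_t -> _) g' : \det (mxsub f' g' (macaulay (nss_bound N d)
    (nss_bound N d + d) (generic_root F i))) = 0 :> {poly K}.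
  by apply/eqP/negPn/negP => nz; apply: all0P; exists f', g'.
set q := \det _ in fg0.
have q0 : q != 0 by apply: contraNneq fg0 => ->; rewrite rmorph0.
have szq : (size q <= nss_size.+1)%N.
  apply: leq_trans (_ : t.+1 <= _)%N => //; apply: size_det_affine => r c.
  rewrite mxE; apply: (augmented_entry (P := fun z : {poly K} => (size z <= 2)%N)).
  - by rewrite size_poly0.
  - by rewrite size_poly1.
  by move=> o m; have [] := coef_generic o m.
have [||a aQ qa] := @roots_of_unity_nonroot K p (k * nss_size.+1) q charK _ q0.
- by rewrite muln_gt0 k_gt0.
- rewrite (leq_ltn_trans szq) // (leq_trans (ltn_expl _ p_gt1)) //.
  by rewrite leq_exp2l // leq_pmull.
exists a, nss_size.+1; split; [by rewrite leqnn|exact: aQ|]; apply/(consistent_add_rootP d_gt0 szF).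
apply/(no_certificateP (horner_eval a) D_gt0 (leqnn _) (size_generic_root d_gt0 szF i)).
exists t => //; split; first by exists f, g.
by move=> f' g'; rewrite minors0 rmorph0.
Qed.
End BoundedStep.

(** * Points in small finite fields *)

(** Taylor's formula at [v], to first order. *)
Lemma in_ideal_meval (R : comNzRingType) N (v : 'I_N -> R) (q : {mpoly R[N]}) :
  in_ideal (fun i => 'X_i - (v i)%:MP) (q - q.@[v]%:MP).
Proof.
pose near (r : {mpoly R[N]}) c := in_ideal (fun i => 'X_i - (v i)%:MP) (r - c%:MP).
have near_refl c : near c%:MP c by rewrite /near subrr; apply: in_ideal0.
have nearM r c r' c' : near r c -> near r' c' -> near (r * r') (c * c').
  move=> nr nr'; rewrite /near mpolyCM.
  have -> : r * r' - c%:MP * c'%:MP = r * (r' - c'%:MP) + c'%:MP * (r - c%:MP).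
    by rewrite !mulrBr [c'%:MP * r]mulrC [c'%:MP * _]mulrC addrA subrK.
  by apply: in_idealD; apply: in_idealM.
have nearX i : near 'X_i (v i).
  exact: (in_ideal_gen (fun i => 'X_i - (v i)%:MP)).
rewrite -/(near q _) mevalE {1}(mpolyE q).
elim/big_rec2: _ => [|m c r _ nr]; first by rewrite -mpolyC0.
rewrite /near mpolyCD opprD addrACA; apply: in_idealD => //.
rewrite -mul_mpolyC; apply: (nearM) => //; rewrite mpolyXE_id.
elim/big_rec2: _ => [|i c' r' _ nr']; first by rewrite -mpolyC1.
apply: (nearM) => //; elim: (m i) => [|e IHe]; first by rewrite !expr0 -mpolyC1.
by rewrite !exprS; apply: (nearM).
Qed.

Lemma fixed_power (K : nzRingType) p k t (x : K) :
  x ^+ (p ^ k) = x -> x ^+ (p ^ (k * t)) = x.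
Proof.
move=> fix_x; elim: t => [|t IHt]; first by rewrite muln0 expn0 expr1.
by rewrite mulnS expnD exprM fix_x.
Qed.

Section Points.
Variables (K : closedFieldType) (p N : nat) (J : finType) (F : J -> {mpoly K[N]}).
Variables (d : nat).
Hypotheses (charK : p \in [pchar K]) (d_gt0 : (0 < d)%N).
Hypothesis szF : forall j, (msize (F j) <= d.+1)%N.
Hypothesis fixF : forall j m, (F j)@_m ^+ p = (F j)@_m.

Let system (v : 'I_N -> K) n (o : J + 'I_N) : {mpoly K[N]} :=
  match o with
  | inl j => F j
  | inr i => if (i < n)%N then 'X_i - (v i)%:MP else 0
  end.

(** One unknown after the other receives its value.  The equations [X_i - v_i]
    added at each stage have coefficients fixed by a higher iterate of
    Frobenius, whose exponent is multiplied by at most [nss_size + 1] each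
    time; the number of equations grows, but the bound ignores it. *)
Lemma bounded_degree_point : consistent F -> exists v tau,
  [/\ (0 < tau <= (nss_size N d).+1 ^ N)%N, forall i, v i ^+ (p ^ tau) = v i
    & forall j, (F j).@[v] = 0].
Proof.
move=> consF; have p_gt0 : (0 < p)%N := prime_gt0 (pcharf_prime charK).
have step n : (n <= N)%N -> exists v tau,
    [/\ (0 < tau <= (nss_size N d).+1 ^ n)%N, forall i, v i ^+ (p ^ tau) = v i
      & consistent (system v n)].
  elim: n => [_|n IHn lt_nN].
    exists (fun=> 0), 1%N; split=> // [i|]; first by rewrite expr0n expn_eq0 eqn0Ngt p_gt0.
    apply: contra_not consF; apply: in_ideal_sub => -[j|i] /=.
      exact: in_ideal_gen.
    exact: in_ideal0.
  have [v [tau [/andP[tau_gt0 le_tau] fixv consv]]] := IHn (ltnW lt_nN).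
  pose i0 := Ordinal lt_nN.
  have [o|o m|a [t [/andP[t_gt0 le_t] fixa consa]]] :=
      @bounded_add_root K N _ (system v n) d d_gt0 _ i0 p tau charK tau_gt0 _ consv.
  - case: o => [j|i] /=; first exact: szF.
    case: ifP => _; last by rewrite msize0.
    rewrite (leq_trans (msizeD_le _ _)) // msizeN msizeC msizeX mdeg1 geq_max.
    by rewrite ltnS d_gt0 (leq_trans (leq_b1 _)).
  - have [phi phiE] := iter_frobenius tau charK.
    case: o => [j|i] /=.
      by rewrite -[tau]mul1n; apply: fixed_power; rewrite expn1 fixF.
    rewrite -phiE; case: ifP => _; last by rewrite mcoeff0 rmorph0.
    by rewrite mcoeffB mcoeffX mcoeffC rmorphB rmorphM !rmorph_nat /= phiE fixv.
  pose v' i := if i == i0 then a else v i.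
  exists v', (tau * t)%N; split.
  - by rewrite muln_gt0 tau_gt0 t_gt0 expnSr leq_mul.
  - by move=> i; rewrite /v'; case: eqP => // _; apply: fixed_power.
  apply: contra_not consa; apply: in_ideal_sub => -[j|i] /=.
    exact: (in_ideal_gen (add_root (system v n) i0 a) (Some (inl j))).
  rewrite /v'; have [->|ne_i] := eqVneq i i0.
    by rewrite ltnSn; apply: (in_ideal_gen (add_root (system v n) i0 a) None).
  rewrite ltnS leq_eqVlt (negPf (ne_i : (i : nat) != i0)) /=.
  have := in_ideal_gen (add_root (system v n) i0 a) (Some (inr i)).
  by rewrite /=.
have [v [tau [le_tau fixv consv]]] := step N (leqnn N).
exists v, tau; split=> // j; apply/eqP/negPn/negP => Fj.
apply: consv; set c := (F j).@[v] in Fj.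
have -> : 1 = (c^-1)%:MP * (F j + (- 1)%:MP * (F j - c%:MP)).
  rewrite mpolyCN mpolyC1 mulN1r opprB addrC subrK -mpolyCM mulVf //.
apply: in_idealM; apply: in_idealD; first exact: (in_ideal_gen (system v N) (inl j)).
apply: in_idealM; apply: in_ideal_sub (in_ideal_meval v (F j)) => i.
have := in_ideal_gen (system v N) (inr i); rewrite /= ltn_ord.
exact.
Qed.
End Points.

Lemma meval_intr (R : comNzRingType) N (v : 'I_N -> R) (q : {mpoly int[N]}) :
  (map_mpoly intr q).@[v] = \sum_(m <- msupp q) (q@_m)%:~R * \prod_i v i ^+ m i.
Proof.
rewrite [X in map_mpoly _ X](mpolyE q) (raddf_sum (map_mpoly (intr : {rmorphism int -> R}))).
rewrite (raddf_sum (meval v)); apply: eq_bigr => m _ /=.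
by rewrite map_mpolyZ map_mpolyX mevalZ mevalX.
Qed.

Section FinitePoints.
Variables (N : nat) (J : finType) (F : J -> {mpoly int[N]}) (d H : nat).
Hypotheses (d_gt0 : (0 < d)%N) (H_gt0 : (0 < H)%N).
Hypothesis szF : forall j, (msize (F j) <= d.+1)%N.
Hypothesis coefF : forall j m, (`|(F j)@_m| <= H)%N.
Local Notation over K G := (fun j => map_mpoly (intr : int -> K) (G j)).

Lemma consistent_of_point (R : comNzRingType) (I : finType) (G : I -> {mpoly R[N]})
    (v : 'I_N -> R) : (forall i, (G i).@[v] = 0) -> consistent G.
Proof.
move=> Gv [g /(congr1 (meval v))]; rewrite meval1 raddf_sum big1 /= => [/eqP|i _].
  by rewrite eq_sym oner_eq0.
by rewrite mevalM Gv mulr0.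
Qed.

Lemma algebraic_closure_pchar (L : finFieldType) p : p \in [pchar L] ->
  exists (K : closedFieldType) (iota : {rmorphism L -> K}), p \in [pchar K].
Proof.
move=> charL; have [K [iota _]] := countable_algebraic_closure L.
by exists K, iota; rewrite (fmorph_pchar iota).
Qed.

Lemma intr_fixed (K : fieldType) p (z : int) : p \in [pchar K] ->
  z%:~R ^+ p = z%:~R :> K.
Proof.
by move=> charK; rewrite -(pFrobenius_autE charK) rmorph_int.
Qed.

Lemma size_map_intr (K : fieldType) (q : {mpoly int[N]}) e : (msize q <= e)%N ->
  (msize (map_mpoly (intr : int -> K) q) <= e)%N.
Proof. exact: leq_trans (msize_map_mpoly _ _). Qed.

(** The solution of [bounded_degree_point] is fixed by an iterate of Frobenius,
    but lies in a closed field that need not contain a given finite field [L]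
    with [p ^ tau] elements.  Since consistency depends only on the
    characteristic, the system with [x_i ^ q = x_i] added is also solvable over
    the closure of [L], and there the roots of [X ^ q - X] are the elements of
    [L]. *)
Theorem small_finite_point (K0 : fieldType) (v0 : 'I_N -> K0) :
    (forall j, (over K0 F j).@[v0] = 0) ->
  exists p tau (L : finFieldType) (v : 'I_N -> L),
  [/\ prime p, (p <= ((nss_size N d)`! * H ^ (nss_size N d)).+1)%N,
      (0 < tau <= (nss_size N d).+1 ^ N)%N, p \in [pchar L] & #|L| = (p ^ tau)%N] /\
      forall j, (over L F j).@[v] = 0.
Proof.
move=> Fv0; have D_gt0 : (0 < nss_bound N d)%N by [].
have [p [pr_p le_p nocert]] : exists p, [/\ prime p,
    (p <= ((nss_size N d)`! * H ^ (nss_size N d)).+1)%N &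
    forall K' : fieldType, p \in [pchar K'] ->
      ~ certificate (nss_bound N d) (over K' F)].
  apply: (certificate_transfer D_gt0 H_gt0 szF coefF (K := K0)) => -[g _ gF].
  by apply: (consistent_of_point Fv0); exists g.
have [K [_ charK]] := algebraic_closure_pchar (pchar_Fp pr_p).
have consK : consistent (over K F).
  apply/(nullstellensatz_certificate d_gt0 (fun j => size_map_intr K (szF j))).
  exact: nocert.
have fixK (K' : fieldType) (I : finType) (G : I -> {mpoly int[N]}) :
    p \in [pchar K'] -> forall j m, (over K' G j)@_m ^+ p = (over K' G j)@_m.
  by move=> charK' j m; rewrite mcoeff_map_mpoly intr_fixed.
have [v [tau [/andP[tau_gt0 le_tau] fixv Fv]]] := bounded_degree_point charK d_gt0
  (fun j => size_map_intr K (szF j)) (fixK _ _ _ charK) consK.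
have [L charL cardL] := pPrimePowerField pr_p tau_gt0.
have [K' [iota charK']] := algebraic_closure_pchar charL.
pose q := (p ^ tau)%N.
pose F' (o : J + 'I_N) : {mpoly int[N]} :=
  match o with inl j => F j | inr i => 'X_i ^+ q - 'X_i end.
pose d' := maxn d q.
have szF' o : (msize (F' o) <= d'.+1)%N.
  case: o => [j|i] /=; first by rewrite (leq_trans (szF j)) // ltnS leq_maxl.
  rewrite (leq_trans (msizeD_le _ _)) // mpolyXn msizeN !msizeX mdegMn mdeg1 mul1n.
  by rewrite geq_max ltnS leq_maxr ltnS /d' leq_max d_gt0.
have d'_gt0 : (0 < d')%N by rewrite leq_max d_gt0.
have eval_var (K1 : fieldType) (x : 'I_N -> K1) i :
    (over K1 F' (inr i)).@[x] = x i ^+ q - x i.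
  by rewrite /= rmorphB rmorphXn /= map_mpolyX mevalB rmorphXn /= mevalXU.
have consK' : consistent (over K' F').
  apply/(nullstellensatz_certificate d'_gt0 (fun j => size_map_intr K' (szF' j))).
  have D'_gt0 : (0 < nss_bound N d')%N by [].
  apply: (certificate_same_pchar D'_gt0 szF' charK charK') => -[g _ gF].
  apply: (@consistent_of_point K _ (over K F') v); last by exists g.
  case=> [j|i] /=; first exact: Fv.
  by rewrite eval_var fixv subrr.
have [v' [_ [_ _ Fv']]] := bounded_degree_point charK' d'_gt0
  (fun j => size_map_intr K' (szF' j)) (fixK _ _ _ charK') consK'.
have in_L i : exists x : L, iota x = v' i.
  have fixv' : v' i ^+ q = v' i.
    by apply/eqP; rewrite -subr_eq0 -eval_var; apply/eqP/(Fv' (inr i)).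
  have roots_q (x : L) : x ^+ q = x by rewrite -[q]/(p ^ tau)%N -cardL expf_card.
  have q_gt1 : (1 < q)%N.
    by rewrite (leq_trans (prime_gt1 pr_p)) // -[X in (X <= _)%N]expn1 leq_exp2l ?prime_gt1.
  pose P : {poly K'} := 'X^q - 'X.
  have szP : size P = q.+1.
    by rewrite size_polyDl ?size_polyN ?size_polyXn ?size_polyX.
  apply: contrapT => no_x; have : (size (v' i :: [seq iota x | x : L]) < size P)%N.
    apply: max_poly_roots.
    - by rewrite -size_poly_gt0 szP.
    - apply/andP; split; first by rewrite /root hornerD hornerN hornerXn hornerX fixv' subrr.
      apply/allP => _ /imageP[x _ ->].
      by rewrite /root hornerD hornerN hornerXn hornerX -rmorphXn roots_q subrr.
    rewrite /= map_inj_uniq ?enum_uniq ?andbT; last exact: fmorph_inj.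
    by apply/negP => /imageP[x _ eq_x]; apply: no_x; exists x.
  by rewrite /= size_image cardL szP ltnn.
have [w wP] := choice in_L.
exists p, tau, L, w; split; first by rewrite tau_gt0.
move=> j; have := Fv' (inl j) => /= Fj.
apply: (fmorph_inj iota); rewrite rmorph0 -Fj.
rewrite !meval_intr rmorph_sum; apply: eq_bigr => m _.
rewrite rmorphM rmorph_int rmorph_prod; congr (_ * _).
by apply: eq_bigr => i _; rewrite rmorphXn wP.
Qed.
End FinitePoints.

(** * Matroid representations as solutions of a polynomial system *)

Lemma free_cols_rank (K : fieldType) m n (A : 'M[K]_(m, n)) (X : {set 'I_n}) :
  free [seq col i A | i in X] =
    (#|X| <= \rank (colsub (fun k : 'I_#|X| => enum_val k) A))%N.
Proof.
set C := colsub _ A; pose s := [tuple of [seq col i A | i in X]].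
have nth_s (k : 'I_#|X|) : s`_k = col (enum_val k) A.
  by rewrite nth_image.
have lin (u : 'I_#|X| -> K) : (\row_k u k) *m C^T = (\sum_k u k *: s`_k)^T.
  apply/rowP => i; rewrite !mxE summxE; apply: eq_bigr => k _.
  by rewrite nth_s !mxE.
rewrite -[X in (_ <= X)%N]mxrank_tr.
apply/(@freeP _ _ _ s)/idP => [free_s | full k uk0 i].
  have : row_free C^T.
    rewrite -kermx_eq0; apply/rowV0P => v /sub_kermxP vC.
    have v_eq : v = \row_k v 0 k by apply/rowP => k; rewrite mxE.
    rewrite v_eq lin in vC; apply/rowP => k; rewrite mxE.
    by apply: (free_s (v 0)); apply: trmx_inj; rewrite vC trmx0.
  by rewrite /row_free => /eqP ->.
have : row_free C^T by rewrite /row_free eqn_leq rank_leq_row full.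
rewrite -kermx_eq0 => /rowV0P/(_ (\row_j k j)) k0.
have /rowP/(_ i) : \row_j k j = 0.
  by apply: k0; apply/sub_kermxP; rewrite lin uk0 trmx0.
by rewrite !mxE.
Qed.

Lemma free_colsP (K : fieldType) m n (A : 'M[K]_(m, n)) (X : {set 'I_n}) :
  reflect (exists g : 'I_#|X| -> 'I_m, \det (mxsub g (fun k : 'I_#|X| => enum_val k) A) != 0)
    (free [seq col i A | i in X]).
Proof.
rewrite free_cols_rank; apply: (iffP (rank_minorP _ _)) => [[f [g fg]]|[g g0]].
  exists f; move: fg; pose e (k : 'I_#|X|) := enum_val k; rewrite -/e.
  have -> : mxsub f g (colsub e A) = mxsub f e A *m colsub g 1%:M.
    by rewrite mulmx_colsub mulmx1; apply/matrixP => i j; rewrite !mxE.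
  by rewrite det_mulmx mulf_eq0 negb_or => /andP[].
exists g, id; move: g0; congr (\det _ != 0).
by apply/matrixP => i j; rewrite !mxE.
Qed.

(** Left multiplication by an invertible matrix does not change which columns are
    independent; it is chosen to make a maximal independent set of columns the
    standard basis. *)
Lemma normal_form (K : fieldType) n (M : matroid 'I_n) : representable_over K M ->
  exists r (phi : 'I_r -> 'I_n) (A : 'M[K]_(r, n)), [/\ injective phi,
    forall i k, A i (phi k) = (i == k)%:R &
    forall X : {set 'I_n}, (X \in indep M) = free [seq col i A | i in X]].
Proof.
move=> [m [A0 repA]]; pose A1 := row_base A0.
have full1 : row_full A1^T by rewrite /row_full mxrank_tr; apply: row_base_free.
pose phi := fullrankfun full1; pose C := colsub phi A1.
have unitC : C \in unitmx.
  have -> : C = (rowsub phi A1^T)^T by apply/matrixP => i j; rewrite !mxE.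
  by rewrite unitmx_tr fullrowsub_unit.
exists (\rank A0), phi, (invmx C *m A1); split.
- exact: fullrankfun_inj.
- move=> i k; have : colsub phi (invmx C *m A1) = 1%:M.
    by rewrite -mulmx_colsub mulVmx.
  by move/matrixP/(_ i k); rewrite !mxE.
move=> X; rewrite repA !free_cols_rank; congr (_ <= _)%N.
pose e (k : 'I_#|X|) := enum_val k; rewrite -/e.
have fullC : row_full (invmx C) by rewrite row_full_unit unitmx_inv.
rewrite -mulmx_colsub (eqmxMfull (colsub e A1) fullC).
apply/eqP; rewrite eqn_leq; apply/andP; split.
  have /submxP[E defA0] : (A0 <= A1)%MS by rewrite eq_row_base.
  have -> : colsub e A0 = E *m colsub e A1 by rewrite mulmx_colsub -defA0.
  exact: mxrankM_maxr.
have /submxP[E defA1] : (A1 <= A0)%MS by rewrite eq_row_base.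
have -> : colsub e A1 = E *m colsub e A0 by rewrite mulmx_colsub -defA1.
exact: mxrankM_maxr.
Qed.

Section CoefficientBound.
Variable N : nat.
Implicit Types p q : {mpoly int[N]}.

(** Bounding the sum of the absolute values of the coefficients, rather than
    their maximum, gives a norm that is submultiplicative.  It is stated
    through an arbitrary expression of [p] as a sum of terms, which need not be
    collected. *)
Definition l1_bound c p := exists2 s : seq (int * 'X_{1..N}),
  p = \sum_(x <- s) x.1 *: 'X_[x.2] & (\sum_(x <- s) `|x.1| <= c)%N.

Lemma l1_bound_coef c p m : l1_bound c p -> (`|p@_m| <= c)%N.
Proof.
move=> [s -> le_c]; apply: leq_trans le_c.
elim: s => [|x s IHs]; first by rewrite !big_nil mcoeff0.
rewrite !big_cons mcoeffD (leq_trans (_ : _ <= `|(x.1 *: 'X_[x.2])@_m|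
    + `|(\sum_(y <- s) y.1 *: 'X_[y.2])@_m|)%N) //.
  by rewrite -lez_nat PoszD !abszE ler_normD.
rewrite leq_add //.
by rewrite mcoeffZ mcoeffX abszM; case: eqP => _; rewrite ?muln1 ?muln0.
Qed.

Lemma l1_boundW c c' p : (c <= c')%N -> l1_bound c p -> l1_bound c' p.
Proof. by move=> le_c [s -> ?]; exists s => //; apply: leq_trans le_c. Qed.

Lemma l1_bound0 : l1_bound 0 0.
Proof. by exists [::]; rewrite ?big_nil. Qed.

Lemma l1_boundX m : l1_bound 1 'X_[m].
Proof. by exists [:: (1, m)]; rewrite ?big_seq1 //= scale1r. Qed.

Lemma l1_bound1 : l1_bound 1 1.
Proof. by rewrite -mpolyX0; apply: l1_boundX. Qed.

Lemma l1_boundN c p : l1_bound c p -> l1_bound c (- p).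
Proof.
move=> [s -> le_c]; exists [seq (- x.1, x.2) | x <- s].
  by rewrite big_map -sumrN; apply: eq_bigr => x _; rewrite scaleNr.
by rewrite big_map; under eq_bigr do rewrite abszN.
Qed.

Lemma l1_boundD c c' p q : l1_bound c p -> l1_bound c' q -> l1_bound (c + c') (p + q).
Proof.
by move=> [s -> le_c] [s' -> le_c']; exists (s ++ s'); rewrite !big_cat ?leq_add.
Qed.

Lemma l1_boundM c c' p q : l1_bound c p -> l1_bound c' q -> l1_bound (c * c') (p * q).
Proof.
move=> [s -> le_c] [s' -> le_c'].
exists [seq (x.1 * y.1, (x.2 + y.2)%MM) | x <- s, y <- s'].
  rewrite big_allpairs_dep mulr_suml; apply: eq_bigr => x _; rewrite mulr_sumr.
  by apply: eq_bigr => y _; rewrite -scalerAl -scalerAr scalerA mpolyXD.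
rewrite big_allpairs_dep (leq_trans _ (leq_mul le_c le_c')) // big_distrl /=.
by apply: leq_sum => x _; rewrite big_distrr /=; under eq_bigr do rewrite abszM.
Qed.

Lemma l1_bound_det t (A : 'M[{mpoly int[N]}]_t) :
  (forall i j, l1_bound 1 (A i j)) -> l1_bound t`! (\det A).
Proof.
move=> bndA; rewrite /determinant -card_Sn -sum1_card.
elim/big_rec2: _ => [|s c q _ bq]; first exact: l1_bound0.
apply: l1_boundD => //; rewrite mulr_sign.
suff bs : l1_bound 1 (\prod_i A i (s i)) by case: ifP => // _; apply: l1_boundN.
elim/big_rec: _ => [|i r _ br]; first exact: l1_bound1.
by rewrite -[1%N]muln1; apply: l1_boundM.
Qed.
End CoefficientBound.

Lemma msize_prod_leq N (R : idomainType) (I : Type) (s : seq I) (P : pred I)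
    (p : I -> {mpoly R[N]}) (e : I -> nat) :
  (forall i, P i -> (msize (p i) <= (e i).+1)%N) ->
  (msize (\prod_(i <- s | P i) p i) <= (\sum_(i <- s | P i) e i).+1)%N.
Proof.
move=> szp; elim/big_rec2: _ => [|i c q Pi szq]; first by rewrite msize1.
rewrite (leq_trans (msizeM_leq _ _)) // -subn1 leq_subLR add1n.
by rewrite (leq_trans (leq_add (szp i Pi) szq)) // addSn addnS.
Qed.

Lemma msize_det N (R : idomainType) t (A : 'M[{mpoly R[N]}]_t) :
  (forall i j, (msize (A i j) <= 2)%N) -> (msize (\det A) <= t.+1)%N.
Proof.
move=> szA; rewrite /determinant (leq_trans (msize_sum _ _ _)) //.
apply/bigmax_leqP => s _; rewrite mulr_sign.
have sz_s : (msize (\prod_i A i (s i)) <= t.+1)%N.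
  rewrite (leq_trans (msize_prod_leq (e := fun=> 1%N) _ _)) //.
  by rewrite sum1_card card_ord.
by case: ifP => // _; rewrite msizeN.
Qed.

Section MatroidSystem.
Variables (n r : nat) (phi : 'I_r -> 'I_n) (M : matroid 'I_n).
Hypothesis phi_inj : injective phi.

(** Only the entries outside the identity block are unknowns.  The extra
    [None] in [sys_var] is the inverse of the product of the chosen minors. *)
Definition entry_var : finType := ('I_r * {j | j \notin codom phi})%type.
Definition sys_var : finType := option entry_var.

Lemma card_sys_var : #|sys_var| = (r * (n - r)).+1.
Proof.
rewrite card_option card_prod card_ord card_sig; congr (_ * _).+1.
have := cardC (mem (codom phi)); rewrite card_codom // !card_ord => card_n.
apply: (@addnI r); rewrite subnKC; first exact: card_n.
by rewrite -card_n leq_addr.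
Qed.

Local Notation N := #|sys_var|.

Definition sys_matrix : 'M[{mpoly int[N]}]_(r, n) := \matrix_(i, j)
  if insub j is Some s then 'X_(enum_rank (Some (i, s) : sys_var))
  else (phi i == j)%:R.

(* The square submatrix, given by its rows, whose determinant is to be nonzero. *)
Variable choice_minor : forall X : {set 'I_n}, option ('I_#|X| -> 'I_r).

Definition sys_minor (X : {set 'I_n}) (g : 'I_#|X| -> 'I_r) : {mpoly int[N]} :=
  \det (mxsub g (fun k : 'I_#|X| => enum_val k) sys_matrix).

Hypothesis choice_some : forall X, X \in indep M -> choice_minor X.

Definition sys_product : {mpoly int[N]} :=
  \prod_(X in indep M) oapp (@sys_minor X) 1 (choice_minor X).

Definition sys_index : finType := option {X : {set 'I_n} & {ffun 'I_#|X| -> 'I_r}}.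

(** A single inverse for the product of all the chosen minors costs one unknown
    where an inverse for each would cost exponentially many.  The zero
    equations for the independent sets keep the index type independent of [M]. *)
Definition matroid_system (o : sys_index) : {mpoly int[N]} :=
  match o with
  | Some Xg => if tag Xg \in indep M then 0 else sys_minor (tagged Xg)
  | None => 'X_(enum_rank (None : sys_var)) * sys_product - 1
  end.

Lemma sys_matrix_entry i j :
  (msize (sys_matrix i j) <= 2)%N /\ l1_bound 1 (sys_matrix i j).
Proof.
rewrite mxE; case: insub => [s|].
  by rewrite msizeX mdeg1; split=> //; apply: l1_boundX.
case: (phi i == j); first by rewrite msize1; split=> //; apply: l1_bound1.
by rewrite msize0; split=> //; apply: l1_boundW (@l1_bound0 _).
Qed.

Lemma card_set_leq (X : {set 'I_n}) : (#|X| <= n)%N.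
Proof. by rewrite -[X in (_ <= X)%N]card_ord max_card. Qed.

Lemma size_sys_minor (X : {set 'I_n}) (g : 'I_#|X| -> 'I_r) :
  (msize (sys_minor g) <= n.+1)%N /\ l1_bound n`! (sys_minor g).
Proof.
split.
  rewrite (leq_trans (msize_det _)) ?ltnS ?card_set_leq // => i j.
  by rewrite mxE; have [] := sys_matrix_entry (g i) (enum_val j).
apply: l1_boundW (leq_fact (card_set_leq X)) _; apply: l1_bound_det => i j.
by rewrite mxE; have [] := sys_matrix_entry (g i) (enum_val j).
Qed.

Lemma card_indep : (#|indep M| <= 2 ^ n)%N.
Proof.
have := card_powerset [set: 'I_n]; rewrite powersetT !cardsT card_ord => <-.
exact: max_card.
Qed.

Lemma size_matroid_system o : (msize (matroid_system o) <= (2 ^ n * n).+2)%N.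
Proof.
have le_n : (n <= 2 ^ n * n)%N by rewrite leq_pmull ?expn_gt0.
case: o => [[X g]|] /=.
  case: ifP => _; first by rewrite msize0.
  by rewrite (leq_trans (proj1 (size_sys_minor g))) // !ltnS leqW.
rewrite (leq_trans (msizeD_le _ _)) // msizeN msize1 geq_max andbT.
rewrite (leq_trans (msizeM_leq _ _)) // msizeX mdeg1 /= add1n ltnS.
rewrite (leq_trans (msize_prod_leq (e := fun=> n) _ _)) //.
  move=> X _; case: (choice_minor X) => [g|] /=; last by rewrite msize1.
  by have [] := size_sys_minor g.
by rewrite ltnS sum_nat_const leq_mul2r card_indep orbT.
Qed.

Lemma coef_matroid_system o m : (`|(matroid_system o)@_m| <= (n`! ^ (2 ^ n)).+1)%N.
Proof.
apply: l1_bound_coef; case: o => [[X g]|] /=.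
  case: ifP => _; first exact: l1_boundW (@l1_bound0 _).
  apply: l1_boundW (proj2 (size_sys_minor g)); apply: leqW.
  by rewrite -[X in (X <= _)%N]expn1 leq_pexp2l ?fact_gt0 ?expn_gt0.
rewrite -addn1; apply: l1_boundD; last exact/l1_boundN/l1_bound1.
rewrite -[X in l1_bound X]mul1n; apply: l1_boundM; first exact: l1_boundX.
apply: l1_boundW (_ : n`! ^ #|indep M| <= _)%N _.
  by rewrite leq_pexp2l ?fact_gt0 ?card_indep.
rewrite -prod_nat_const /sys_product.
elim/big_rec2: _ => [|X c q _ bq]; first exact: l1_bound1.
apply: l1_boundM bq; case: (choice_minor X) => [g|] /=.
  by have [] := size_sys_minor g.
by apply: l1_boundW (@l1_bound1 _); rewrite fact_gt0.
Qed.

Section Evaluation.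
Variables (K : fieldType) (w : 'I_N -> K).
Local Notation eval q := ((map_mpoly (intr : int -> K) q).@[w]).

Definition sys_eval_matrix : 'M[K]_(r, n) := \matrix_(i, j) eval (sys_matrix i j).

Let evalM p q : eval (p * q) = eval p * eval q.
Proof. by rewrite rmorphM mevalM. Qed.

Lemma eval_minor (X : {set 'I_n}) (g : 'I_#|X| -> 'I_r) : eval (sys_minor g) =
  \det (mxsub g (fun k : 'I_#|X| => enum_val k) sys_eval_matrix).
Proof.
rewrite /sys_minor -!det_map_mx; congr (\det _).
by apply/matrixP => i j; rewrite !mxE.
Qed.

Lemma eval_product : eval sys_product = \prod_(X in indep M) oapp
  (fun g : 'I_#|X| -> 'I_r =>
     \det (mxsub g (fun k : 'I_#|X| => enum_val k) sys_eval_matrix))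
  1 (choice_minor X).
Proof.
rewrite /sys_product !rmorph_prod; apply: eq_bigr => X _.
case: (choice_minor X) => [g|] /=; first exact: eval_minor.
by rewrite rmorph1 meval1.
Qed.

Lemma representable_of_point :
  (forall o, eval (matroid_system o) = 0) -> representable_over K M.
Proof.
move=> sol; exists r, sys_eval_matrix => X.
have prod_neq0 : eval sys_product != 0.
  apply/negP => /eqP prod0; have := sol None.
  rewrite /= rmorphB mevalB evalM prod0 mulr0 rmorph1 meval1 sub0r => /eqP.
  by rewrite oppr_eq0 oner_eq0.
apply/idP/free_colsP => [indX|[g g0]].
  move: prod_neq0; rewrite eval_product => /prodf_neq0/(_ X indX).
  by have := choice_some indX; case: (choice_minor X) => // g _ /= g0; exists g.
apply: contraNT g0 => depX.
have := sol (Some (Tagged _ [ffun k => g k])); rewrite /= (negPf depX) eval_minor.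
move=> <-; apply/eqP; congr (\det _); apply/matrixP => i j.
by rewrite !mxE /= ffunE.
Qed.
End Evaluation.

Lemma point_of_representation (K : fieldType) (A : 'M[K]_(r, n)) :
    (forall i k, A i (phi k) = (i == k)%:R) ->
    (forall X : {set 'I_n}, (X \in indep M) = free [seq col i A | i in X]) ->
    (forall (X : {set 'I_n}) g, choice_minor X = Some g ->
       \det (mxsub g (fun k : 'I_#|X| => enum_val k) A) != 0) ->
  exists w : 'I_N -> K, forall o, (map_mpoly (intr : int -> K) (matroid_system o)).@[w] = 0.
Proof.
move=> normA repA minorA.
pose G := \prod_(X in indep M) oapp (fun g : 'I_#|X| -> 'I_r =>
  \det (mxsub g (fun k : 'I_#|X| => enum_val k) A)) 1 (choice_minor X).
have G0 : G != 0.
  apply/prodf_neq0 => X _; case eq_g: (choice_minor X) => [g|] /=.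
    exact: minorA eq_g.
  exact: oner_neq0.
pose w (i : 'I_N) := if (enum_val i : sys_var) is Some (a, s) then A a (val s) else G^-1.
have wA : sys_eval_matrix w = A.
  apply/matrixP => i j; rewrite !mxE; case: insubP => [s _ <-|].
    by rewrite map_mpolyX mevalXU /w enum_rankK.
  rewrite negbK => /codomP[k ->].
  by rewrite rmorph_nat mevalMn meval1 normA (inj_eq phi_inj).
exists w => -[[X g]|] /=.
  case: ifPn => [_|depX]; first by rewrite rmorph0 meval0.
  rewrite eval_minor wA; apply/eqP; apply: contraNT depX => nz.
  by rewrite repA; apply/free_colsP; exists g.
rewrite rmorphB rmorphM /= mevalB mevalM map_mpolyX mevalXU rmorph1 meval1.
by rewrite eval_product wA /w enum_rankK mulVf ?subrr.
Qed.
End MatroidSystem.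

(** The chosen minors are those that are nonzero in the given representation. *)
Theorem representable_finite (K0 : fieldType) n (M : matroid 'I_n) :
  representable_over K0 M -> exists r p tau (L : finFieldType),
    let S := nss_size (r * (n - r)).+1 (2 ^ n * n).+1 in
    [/\ (r <= n)%N, prime p /\ (p <= (S`! * (n`! ^ (2 ^ n)).+1 ^ S).+1)%N,
        (tau <= S.+1 ^ (r * (n - r)).+1)%N, p \in [pchar L] /\ #|L| = (p ^ tau)%N &
        representable_over L M].
Proof.
move=> /normal_form[r [phi [A [phi_inj normA repA]]]].
have minors (X : {set 'I_n}) : exists og : option ('I_#|X| -> 'I_r),
    (X \in indep M -> og) /\ forall g, og = Some g ->
    \det (mxsub g (fun k : 'I_#|X| => enum_val k) A) != 0.
  have [indX|_] := boolP (X \in indep M); last by exists None.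
  have := indX; rewrite repA => /free_colsP[g g0].
  by exists (Some g); split=> // _ [<-].
have ch : {og : forall X : {set 'I_n}, option ('I_#|X| -> 'I_r) & forall X,
    (X \in indep M -> og X) /\ forall g, og X = Some g ->
    \det (mxsub g (fun k : 'I_#|X| => enum_val k) A) != 0}.
  exists (fun X => projT1 (cid (minors X))) => X.
  exact: projT2 (cid (minors X)).
have [og ogP] := ch.
have og_some X : X \in indep M -> og X by have [] := ogP X.
have [w wP] := point_of_representation phi_inj normA repA (fun X => proj2 (ogP X)).
have [p [tau [L [v [[pr_p le_p /andP[_ le_tau] charL cardL] vP]]]]] :=
  small_finite_point (ltn0Sn _) (ltn0Sn _) (@size_matroid_system n r phi M og)
    (@coef_matroid_system n r phi M og) wP.
rewrite card_sys_var // in le_p le_tau.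
exists r, p, tau, L; split=> //; last exact: (representable_of_point (w := v) og_some vP).
by have := leq_card phi phi_inj; rewrite !card_ord.
Qed.

(** * Numerical estimates *)

Lemma leq_exp2n n : (n <= 2 ^ n)%N. Proof. exact/ltnW/ltn_expl. Qed.

Lemma pow_leq a b m : (a <= b)%N -> (a ^ m <= b ^ m)%N.
Proof. by case: m => // m le_ab; rewrite leq_exp2r. Qed.

Lemma fact_leq m : (m`! <= m ^ m)%N.
Proof.
elim: m => // m IHm; rewrite factS expnS leq_mul2l /= (leq_trans IHm) //.
by rewrite pow_leq.
Qed.

Lemma quarter_square r n : (r <= n)%N -> (4 * (r * (n - r)) <= n ^ 2)%N.
Proof. by move=> le_rn; rewrite -{2}(subnKC le_rn) nat_AGM2. Qed.

Section Arithmetic.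
Variables (n r : nat).
Hypotheses (n_ge3 : (3 <= n)%N) (le_rn : (r <= n)%N).
Let N := (r * (n - r)).+1.
Let d := (2 ^ n * n).+1.
Let S := nss_size N d.
Let H := (n`! ^ (2 ^ n)).+1.
(* The orders of the minors are at most [2 ^ e], and [e] is about [3 n N ^ 2]. *)
Let e := (N * (4 * n + 3 * n * N + 1))%N.

Let N_leq : (4 * N <= n ^ 2 + 4)%N.
Proof. by have := quarter_square le_rn; rewrite /N; lia. Qed.

Let N_exp : (N + 2 <= 2 ^ n)%N.
Proof.
have sq m : ((m + 3) ^ 2 + 12 <= 4 * 2 ^ (m + 3))%N.
  elim: m => [|m IHm] //; rewrite addSn; move: IHm; rewrite -!mulnn.
  have : (3 * (m + 3) <= (m + 3) * (m + 3))%N by rewrite leq_mul2r leq_addl orbT.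
  move: (m + 3)%N => x.
  have -> : (x.+1 * x.+1 = x * x + 2 * x + 1)%N by lia.
  rewrite expnS; lia.
by have := sq (n - 3)%N; rewrite subnK //; lia.
Qed.

(** From [4 N <= n ^ 2 + 4], [16 e] is at most [3 n ^ 5] plus terms in [n ^ 3]
    and below; for [n >= 3] the difference to [16 n ^ 5] absorbs them. *)
Let e_leq : (e + 3 * n + 4 <= n ^ 5)%N.
Proof.
have h2 : (3 * n <= n ^ 2)%N by rewrite -mulnn leq_mul2r n_ge3 orbT.
have h3 : (3 * n ^ 2 <= n ^ 3)%N by rewrite [(n ^ 3)%N]expnS leq_mul2r n_ge3 orbT.
have h5 : (9 * n ^ 3 <= n ^ 5)%N.
  by rewrite (expnD n 2 3) leq_mul2r (leq_sqr 3) n_ge3 orbT.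
have : (16 * e <= (n ^ 2 + 4) * (3 * n ^ 3 + 28 * n + 4))%N.
  have -> : (16 * e = (4 * N) * (4 * (4 * n + 1) + 3 * n * (4 * N)))%N by rewrite /e; lia.
  have -> : (3 * n ^ 3 + 28 * n + 4 = 4 * (4 * n + 1) + 3 * n * (n ^ 2 + 4))%N.
    by rewrite [(n ^ 3)%N]expnS; lia.
  by rewrite leq_mul // leq_add2l leq_mul2l N_leq orbT.
have -> : ((n ^ 2 + 4) * (3 * n ^ 3 + 28 * n + 4)
         = 3 * n ^ 5 + 40 * n ^ 3 + 4 * n ^ 2 + 112 * n + 16)%N.
  by rewrite (expnD n 2 3) [(n ^ 3)%N]expnS; lia.
lia.
Qed.

Let S_leq : (S <= 2 ^ e)%N.
Proof.
have d_leq : (d <= 2 ^ (2 * n))%N.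
  rewrite mul2n -addnn expnD (@leq_trans (2 ^ n * n.+1)) //.
    by rewrite /d mulnS -addn1 addnC leq_add2r expn_gt0.
  by rewrite leq_mul2l ltn_expl ?orbT.
have N1_leq : (N.+1 <= 2 ^ n)%N by rewrite (leq_trans _ N_exp) // addn2.
have N2_leq : (N.+2 <= 2 ^ n)%N by rewrite (leq_trans _ N_exp) // addn2.
have bound_leq : (nss_bound N d <= (2 ^ (4 * n + 3 * n * N)).+1)%N.
  rewrite /nss_bound ltnS.
  have -> : (4 * n + 3 * n * N = 2 * n + (n + ((2 * n + n) * N + n)))%N by lia.
  rewrite (expnD 2 (2 * n)) (expnD 2 n) (expnD 2 ((2 * n + n) * N)).
  do 3!apply: leq_mul => //.
  by rewrite expnM leq_exp2r // expnD leq_mul.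
rewrite /S /nss_size /e mulnC expnM leq_exp2r // addn1 expnS mul2n -addnn.
have -> : (4 * n + 3 * n * N = 2 * n + (2 * n + 3 * n * N))%N by lia.
have lt_d : (d < 2 ^ (2 * n) * 2 ^ (2 * n + 3 * n * N))%N.
  rewrite (leq_ltn_trans d_leq) // -[X in (X < _)%N]muln1 ltn_mul2l expn_gt0 /=.
  by rewrite -[X in (X < _)%N](expn0 2) ltn_exp2l //; lia.
have := bound_leq.
have -> : (4 * n + 3 * n * N = 2 * n + (2 * n + 3 * n * N))%N by lia.
rewrite expnD; lia.
Qed.

Let H_leq : (H <= 2 ^ (2 ^ (3 * n)))%N.
Proof.
have nn : (n ^ n <= 2 ^ (n * n))%N.
  by rewrite expnM leq_exp2r ?leq_exp2n // (leq_trans _ n_ge3).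
have lt_nn : (n * n < 2 ^ n * 2 ^ n)%N by rewrite ltn_mul // ltn_expl.
rewrite /H; apply: (@leq_trans (2 ^ (n * n * 2 ^ n)).+1).
  rewrite ltnS expnM leq_exp2r ?expn_gt0 // (leq_trans (fact_leq n)) //.
rewrite ltn_exp2l //.
have -> : (2 ^ (3 * n) = 2 ^ n * 2 ^ n * 2 ^ n)%N.
  by rewrite -!expnD; congr (2 ^ _)%N; lia.
by rewrite ltn_mul2r expn_gt0.
Qed.

Let e_exp : (e + 2 ^ (3 * n) < 2 ^ (3 * n + 3))%N.
Proof.
have N1_leq : (N.+1 <= 2 ^ n)%N by rewrite (leq_trans _ N_exp) // addn2.
have e_leq' : (e <= 2 ^ n * (4 * (2 ^ n * 2 ^ n)))%N.
  apply: leq_mul; first exact: ltnW.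
  apply: (@leq_trans (4 * (n * N.+1))); last by rewrite leq_mul2l leq_mul ?leq_exp2n.
  have : (1 <= n * N)%N by rewrite muln_gt0 (leq_trans _ n_ge3).
  by rewrite mulnS; lia.
have cube : (2 ^ (3 * n) = 2 ^ n * (2 ^ n * 2 ^ n))%N.
  by rewrite -!expnD; congr (2 ^ _)%N; lia.
have : (0 < 2 ^ (3 * n))%N by rewrite expn_gt0.
rewrite (expnD 2 (3 * n)) cube (_ : 2 ^ 3 = 8)%N //; move: e_leq'; rewrite mulnCA.
by move: (2 ^ n * (2 ^ n * 2 ^ n))%N => x; lia.
Qed.

Lemma prime_bound : ((S`! * H ^ S).+1 <= 2 ^ (2 ^ (n ^ 5)))%N.
Proof.
have SH_leq : (S`! * H ^ S <= 2 ^ ((e + 2 ^ (3 * n)) * 2 ^ e))%N.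
  rewrite (leq_trans (leq_mul (fact_leq S) (leqnn _))) // -expnMn.
  apply: (@leq_trans ((2 ^ (e + 2 ^ (3 * n))) ^ S)).
    by apply: pow_leq; rewrite expnD leq_mul ?S_leq ?H_leq.
  by rewrite -expnM leq_exp2l // leq_mul2l S_leq orbT.
apply: (@leq_trans (2 ^ ((e + 2 ^ (3 * n)) * 2 ^ e).+1)).
  rewrite expnS mul2n -addnn -addn1 leq_add ?expn_gt0 //.
rewrite leq_exp2l //; apply: (@leq_trans (2 ^ (3 * n + 3) * 2 ^ e)).
  rewrite (@leq_trans ((e + 2 ^ (3 * n)).+1 * 2 ^ e)) ?leq_mul2r ?e_exp ?orbT //.
  by rewrite mulSn -add1n leq_add2r expn_gt0.
by have := e_leq; rewrite -expnD leq_exp2l //; lia.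
Qed.

Lemma order_bound p tau : (p <= (S`! * H ^ S).+1)%N -> (tau <= S.+1 ^ N)%N ->
  (p ^ tau <= 2 ^ (2 ^ (2 ^ (n ^ 3))))%N.
Proof.
move=> le_p le_tau.
have tau_leq : (tau <= 2 ^ (e.+1 * N))%N.
  rewrite (leq_trans le_tau) // expnM; apply: pow_leq.
  by rewrite expnS mul2n -addnn -addn1 leq_add ?expn_gt0.
rewrite (leq_trans (pow_leq tau (leq_trans le_p prime_bound))) //.
rewrite -expnM leq_exp2l // (leq_trans (leq_mul (leqnn _) tau_leq)) //.
rewrite -expnD leq_exp2l //.
have n5 : (n ^ 5 <= 2 ^ (5 * n))%N by rewrite mulnC expnM leq_exp2r ?leq_exp2n.
have e5 : (e.+1 * N <= 2 ^ (5 * n) * 2 ^ n)%N.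
  apply: leq_mul; first by rewrite (leq_trans _ n5) //; have := e_leq; lia.
  by rewrite (leq_trans _ N_exp) // leq_addr.
have n3 : (6 * n + 1 <= n ^ 3)%N.
  have : (9 * n <= n ^ 3)%N by rewrite (expnS n 2) mulnC leq_mul2l (leq_sqr 3) n_ge3 orbT.
  lia.
rewrite (@leq_trans (2 ^ (6 * n + 1))) ?leq_exp2l //.
have -> : (2 ^ (6 * n + 1) = 2 ^ (5 * n) * 2 ^ n * 2)%N.
  by rewrite -expnD -expnSr; congr (2 ^ _)%N; lia.
have : (2 ^ (5 * n) <= 2 ^ (5 * n) * 2 ^ n)%N by rewrite leq_pmulr ?expn_gt0.
by move: (2 ^ (5 * n) * 2 ^ n)%N n5 e5; lia.
Qed.
End Arithmetic.

(** * Ground sets with at most two elements *)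

Section BinaryPattern.
Variables (K : fieldType) (n r : nat) (phi : 'I_r -> 'I_n) (A : 'M[K]_(r, n)).

Lemma free_normal_cols (X : {set 'I_n}) :
    (forall i k, A i (phi k) = (i == k)%:R) -> {subset X <= codom phi} ->
  free [seq col i A | i in X].
Proof.
move=> normA sX; apply/free_colsP.
have sX' (k : 'I_#|X|) : enum_val k \in codom phi by apply/sX/enum_valP.
exists (fun k => iinv (sX' k)).
suff -> : mxsub (fun k => iinv (sX' k)) (fun k : 'I_#|X| => enum_val k) A = 1%:M.
  by rewrite det1 oner_neq0.
apply/matrixP => i j; rewrite !mxE -[in LHS](f_iinv (sX' j)) normA.
congr (_ %:R); congr nat_of_bool; apply/eqP/eqP => [eq_ij|-> //].
by apply: enum_val_inj; rewrite -(f_iinv (sX' i)) eq_ij f_iinv.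
Qed.

Definition binary_pattern : 'M['F_2]_(r, n) := \matrix_(i, j) (A i j != 0)%:R.

(** With a single row, a determinant of order at least two has two equal rows,
    and one of order one is an entry. *)
Lemma det_binary_pattern t (g : 'I_t -> 'I_r) (e : 'I_t -> 'I_n) : (r <= 1)%N ->
  (\det (mxsub g e binary_pattern) != 0) = (\det (mxsub g e A) != 0).
Proof.
move=> le_r1; case: t g e => [|[|t]] g e.
- by rewrite !det_mx00 !oner_eq0.
- by rewrite !det_mx11 !mxE; case: (A _ _ == 0); rewrite ?eqxx ?oner_eq0.
have g01 : g ord0 = g (lift ord0 ord0).
  by case: r le_r1 g => [|[]] // _ g; [case: (g ord0) | rewrite !ord1].
by rewrite !(@determinant_alternate _ _ _ ord0 (lift ord0 ord0)) ?eqxx // => i;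
  rewrite !mxE g01.
Qed.
End BinaryPattern.

(** The normal form has rank at most one or, for [n = 2], rank two with all
    elements in the basis. *)
Lemma representable_binary (K : fieldType) n (M : matroid 'I_n) : (n <= 2)%N ->
  representable_over K M -> representable_over 'F_2 M.
Proof.
move=> le_n2 /normal_form[r [phi [A [phi_inj normA repA]]]].
exists r, (binary_pattern A) => X; rewrite repA.
have le_rn : (r <= n)%N by have := leq_card phi phi_inj; rewrite !card_ord.
have [le_r1|lt_1r] := leqP r 1.
  by apply/free_colsP/free_colsP => -[g g0]; exists g; move: g0;
    rewrite det_binary_pattern.
have onto : {subset X <= codom phi}.
  move=> j _; have -> // := inj_card_onto phi_inj _.
  by rewrite !card_ord (leq_trans le_n2).
rewrite !(@free_normal_cols _ _ _ phi) // => i k.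
by rewrite !mxE normA; case: (i == k); rewrite ?eqxx ?oner_eq0.
Qed.

(** * The bounds *)

Lemma matroid_bounds (K : fieldType) n (M : matroid 'I_n) :
    (0 < n)%N -> representable_over K M ->
  exists p q (L : finFieldType), [/\ (p <= 2 ^ (2 ^ (n ^ 5)))%N,
    (q <= 2 ^ (2 ^ (2 ^ (n ^ 3))))%N, p \in [pchar L], #|L| = q & representable_over L M].
Proof.
move=> n_gt0 repM; have [n_ge3|n_le2] := ltnP 2 n.
  have [r [p [tau [L [le_rn [_ le_p] le_tau [charL cardL] repL]]]]] :=
    representable_finite repM.
  exists p, (p ^ tau)%N, L; split=> //; last exact: order_bound le_p le_tau.
  exact/(leq_trans le_p)/prime_bound.
exists 2, 2, 'F_2; split; last exact: representable_binary repM.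
- by rewrite -[X in (X <= _)%N](expn1 2) leq_exp2l ?expn_gt0.
- by rewrite -[X in (X <= _)%N](expn1 2) leq_exp2l ?expn_gt0.
- exact: pchar_Fp.
- exact: card_Fp.
Qed.

Section Extended.
Variable R : realType.

Lemma least_leq (P : nat -> Prop) k l : P k -> (k <= l)%N ->
  (least R P <= l%:R%:E)%E.
Proof.
move=> Pk le_kl; rewrite /least; case: pselect => [exP|[]]; last first.
  by exists k; apply/asboolP.
rewrite lee_fin ler_nat; case: ex_minnP => m _ min_m.
by rewrite (leq_trans _ le_kl) // min_m //; apply/asboolP.
Qed.

Lemma log2_leq (x : \bar R) m :
  (x <= (2 ^ m)%N%:R%:E)%E -> (log2 x <= m%:R%:E)%E.
Proof.
move=> le_x; rewrite /log2.
have ln2 : 0 < (ln 2 : R) by rewrite ln_gt0 // ltr1n.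
have [x_gt0|x_le0] := ltP 0%E x; last first.
  by rewrite le0_lneNy // gt0_mulNye ?leNye // lte_fin invr_gt0.
have le_ln : (lne x <= (m%:R * ln 2)%:E)%E.
  have -> : ((m%:R * ln 2)%:E = lne ((2 ^ m)%N%:R%:E) :> \bar R)%E.
    by rewrite lne_EFin ?ltr0n ?expn_gt0 // natrX lnXn // mulr_natl.
  by rewrite lee_lne ?in_itv /= ?leey ?andbT ?(ltW x_gt0) // ?lee_fin ?ler0n.
have inv_ge0 : (0 <= ((ln 2 : R)^-1)%:E)%E by rewrite lee_fin invr_ge0 ltW.
rewrite (Order.POrderTheory.le_trans (lee_wpmul2r inv_ge0 le_ln)) //.
by rewrite -EFinM mulfK // gt_eqF.
Qed.

Lemma matroid_max_leq n (F : matroid 'I_n -> \bar R) k :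
    (forall M, representable M -> (F M <= k%:R%:E)%E) ->
  (\big[maxe/-oo%E]_(M : matroid 'I_n | `[< representable M >]) F M <= k%:R%:E)%E.
Proof.
move=> bndF; elim/big_rec: _ => [|M x /asboolP repM le_x]; first exact: leNye.
by rewrite ge_max bndF.
Qed.

End Extended.

Theorem theorem3 (R : realType) (n : nat) (hn : (0 < n)%N) :
  (log2 (log2 (c R n)) <= (n ^ 5)%N%:R%:E)%E /\
  (log2 (log2 (log2 (f R n))) <= (n ^ 3)%N%:R%:E)%E.
Proof.
split.
  do 2!apply: log2_leq; apply: matroid_max_leq => M [K repM].
  have [p [q [L [le_p _ charL _ repL]]]] := matroid_bounds hn repM.
  by apply: least_leq le_p; exists L.
do 3!apply: log2_leq; apply: matroid_max_leq => M [K repM].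
have [p [q [L [_ le_q _ cardL repL]]]] := matroid_bounds hn repM.
by apply: least_leq le_q; exists L.
Qed.
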